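(* Let $G$ be a finite group and let $\rho$ be a representation of $G$. Assume that the McKay graph $\Gamma(G,\rho)$ is an (undirected) forest. Then: (1) $\rho$ is irreducible and self-dual. (2) Each connected component of $\Gamma(G,\rho)$ is isomorphic (as a graph) to one of the following: (a) an affine Dynkin diagram of type $\tilde D_n$, $n\ge 4$; (b) an affine Dynkin diagram of type $\tilde E_n$ for $n\in\{6,7,8\}$; (c) a hedgehog with $4^n$ leaves, for some $n\ge 0$. Furthermore, if one of the components is a hedgehog with $4^n$ leaves with $n\ne 1$, then it is isomorphic to each of the remaining components.
   Context: All representations are finite-dimensional over $\mathbb C$. $\mathrm{Irr}(G)$ is the set of isomorphism classes of irreducible representations of $G$. The McKay graph $\Gamma(G,\rho)$ is the directed graph (multiple edges and loops allowed) with vertex set $\mathrm{Irr}(G)$ in which the number of edges from $\pi$ to $\tau$ is $\dim \mathrm{Hom}_G(\pi\otimes\rho,\tau)$. A directed graph is called undirected if its adjacency matrix is symmetric; then each pair of opposite directed edges is regarded as one undirected edge. An undirected forest is an undirected graph with no closed paths (a path does not repeat edges); in particular it has no loops and at most one undirected edge between any two vertices. Equivalently, it is a disjoint union of trees. $\tilde D_n$ ($n\ge4$) is the tree on $n+1$ vertices obtained from a path with $n-3$ vertices by attaching two extra leaves at each of its two end vertices (for $n=4$ the path is a single vertex, and four leaves are attached to it). $\tilde E_6,\tilde E_7,\tilde E_8$ are the trees with one trivalent vertex from which three paths emanate, containing respectively $(2,2,2)$, $(1,3,3)$, $(1,2,5)$ further vertices. A hedgehog with $4^n$ leaves ($n\ge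 0$) is the tree consisting of one vertex together with $4^n$ other vertices, each joined by a single undirected edge to that vertex and to nothing else; for $n=0$ it is the graph with $2$ vertices and one undirected edge between them.
   Formalization: The representation ρ is assumed to be nonzero; for ρ = 0 the McKay graph has no edges and so is a forest, but ρ is not irreducible and the components are isolated vertices, so the claim fails there. *)

(* Defs.v *)
From HB Require Import structures.
From mathcomp Require Import all_boot all_order all_algebra all_fingroup.
From mathcomp Require Import all_character.
From mathcomp Require Import complex reals.

Set Implicit Arguments.
Unset Strict Implicit.
Unset Printing Implicit Defensive.

Import GRing.Theory.
Local Open Scope ring_scope.

(** * Directed multigraphs *)

(** [edges x y] is the number of directed edges from [x] to [y]. *)
Record digraph := Digraph { vertex :> finType; edges : vertex -> vertex -> nat }.

Definition undirected (X : digraph) : Prop :=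
  forall x y : X, edges x y = edges y x.

(** A step [(x, y, k)] traverses the [k]-th edge (counted from 0) from [x] to
    [y].  In an undirected graph the [k]-th edges from [x] to [y] and from [y]
    to [x] form a single undirected edge, hence [edge_of] forgets the
    orientation. *)
Definition edge_of (X : digraph) (s : X * X * nat) : {set X} * nat :=
  ([set s.1.1; s.1.2], s.2).

Definition closed_path (X : digraph) (p : seq (X * X * nat)) : bool :=
  [&& p != [::],
      all (fun s => s.2 < edges s.1.1 s.1.2)%N p,
      path.cycle (fun s t => s.1.2 == t.1.1) p
    & uniq [seq edge_of s | s <- p]].

Definition undirected_forest (X : digraph) : Prop :=
  undirected X /\ forall p : seq (X * X * nat), ~~ closed_path p.

Definition adjacent (X : digraph) : rel X :=
  fun x y => (0 < edges x y)%N || (0 < edges y x)%N.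

Definition component (X : digraph) (x : X) : digraph :=
  @Digraph {y : X | connect (@adjacent X) x y}
           (fun y z => edges (val y) (val z)).

Definition graph_iso (X Y : digraph) : Prop :=
  exists2 f : X -> Y, bijective f
    & forall x y : X, edges (f x) (f y) = edges x y.

(** * The trees of the classification *)

Definition simple_graph (T : finType) (r : rel T) : digraph :=
  @Digraph T (fun x y => r x y || r y x : nat).

(** [inl i], [i < n - 3], are the vertices of the path; [inr (b, c)], for
    [c : bool], are the two leaves attached to its first ([b = false]) or last
    ([b = true]) vertex.  Only meaningful for [4 <= n]. *)
Definition affineD (n : nat) : digraph :=
  simple_graph (T := ('I_(n - 3) + bool * bool)%type) (fun x y =>
    match x, y with
    | inl i, inl j => j == i.+1 :> nat
    | inl i, inr (b, _) => i == (if b then n - 4 else 0)%N :> nat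
    | _, _ => false
    end).

(** A centre [None] from which paths with [arms`_0], [arms`_1], ... further
    vertices emanate; [Some (Tagged _ i)] is the [i]-th vertex of an arm,
    counted from 0 outwards. *)
Definition starlike (arms : seq nat) : digraph :=
  simple_graph (T := option {k : 'I_(size arms) & 'I_(nth 0%N arms k)})
    (fun x y =>
    match x, y with
    | None, Some v => tagged v == 0%N :> nat
    | Some u, Some v => (tag u == tag v) && (tagged v == (tagged u).+1 :> nat)
    | _, _ => false
    end).

(** Only meaningful for [n] in [{6, 7, 8}]. *)
Definition affineE (n : nat) : digraph :=
  starlike (match n with
            | 6 => [:: 2; 2; 2]
            | 7 => [:: 1; 3; 3]
            | _ => [:: 1; 2; 5]
            end%N).

Definition hedgehog (m : nat) : digraph :=
  simple_graph (T := option 'I_m) (fun x y => (x == None) && (y != None)).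

(** * Representations and the McKay graph *)

(** The field of complex numbers, for [R] the field of real numbers. *)
Definition complexes (R : realType) : numClosedFieldType := R[i]%C.

Lemma dual_mx_repr (F : fieldType) (gT : finGroupType) (G : {group gT})
    (n : nat) (V : mx_representation F G n) :
  mx_repr G (fun g => (V g^-1%g)^T).
Proof.
split=> [|x y Gx Gy]; first by rewrite invg1 repr_mx1 trmx1.
by rewrite invMg repr_mxM ?groupV // trmx_mul.
Qed.

Definition dual_repr (F : fieldType) (gT : finGroupType) (G : {group gT})
    (n : nat) (V : mx_representation F G n) : mx_representation F G n :=
  MxRepresentation (dual_mx_repr V).

(** Representations act on row vectors, so [f : 'M_(m, n)] is a
    [G]-homomorphism iff it satisfies the equations of [memv_hom_repr]. *)
Definition hom_repr (F : fieldType) (gT : finGroupType) (G : {group gT})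
    (m n : nat) (V : mx_representation F G m) (W : mx_representation F G n) :
    {vspace 'M[F]_(m, n)} :=
  (\bigcap_(g in G) lker (linfun (mulmx (V g)) - linfun (mulmxr (W g))))%VS.

Lemma memv_hom_repr (F : fieldType) (gT : finGroupType) (G : {group gT})
    (m n : nat) (V : mx_representation F G m) (W : mx_representation F G n)
    (f : 'M[F]_(m, n)) :
  f \in hom_repr V W <-> {in G, forall g, V g *m f = f *m W g}.
Proof.
have memE g : (f \in lker (linfun (mulmx (V g)) - linfun (mulmxr (W g))))
    = (V g *m f == f *m W g).
  by rewrite memv_ker add_lfunE opp_lfunE !lfunE subr_eq0.
rewrite memvE; split=> homf => [g Gg|].
  by apply/eqP; rewrite -memE memvE; move/subv_bigcapP: homf; apply.
by apply/subv_bigcapP=> g Gg; rewrite -memvE memE; apply/eqP/homf.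
Qed.

(** Irr(G): the components of the regular representation index the irreducible
    representations up to isomorphism when the characteristic does not divide
    the order of [G], in particular over [complexes R]; [irr_repr] is the corresponding
    representation. *)
Definition Irr (F : decFieldType) (gT : finGroupType) (G : {group gT}) :
    irrType F G :=
  DecSocleType (regular_repr F G).

Definition McKay (F : decFieldType) (gT : finGroupType) (G : {group gT})
    (d : nat) (rho : mx_representation F G d) : digraph :=
  @Digraph (Irr F G) (fun i j =>
    \dim (hom_repr (prod_repr (irr_repr i) rho) (irr_repr j))).

(* Main.v *)
Require Import Defs.
From HB Require Import structures.
From mathcomp Require Import all_boot all_order all_algebra all_fingroup.
From mathcomp Require Import all_solvable all_character.
From mathcomp Require Import complex reals zify.

Set Implicit Arguments.
Unset Strict Implicit.
Unset Printing Implicit Defensive.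

(** Let [v x] be the dimension of the irreducible representation [x] and [d] the
    dimension of [rho].  Decomposing [x (x) rho] shows that [v] is a positive
    eigenvector of the adjacency matrix, of eigenvalue [d] ([McKay_weight]).
    Everything else combines this equation with one property of forests: a walk
    that never returns along the edge just used never meets a vertex twice
    ([nbwalk_uniq]).

    _Irreducibility._  The neighbours of the trivial representation are the
    constituents of [rho], in one direction, and of its dual, in the other, so
    [rho] is self-dual.  If [rho] had two constituents [t1] and [t2], a
    nontrivial constituent of [t1 (x) t2] would be adjacent to both and close a
    4-cycle through the trivial representation.  So [t1 (x) t2] is trivial and
    all constituents of [rho] are linear; then [v] is constant on components,
    every vertex has [d >= 2] neighbours, and a finite forest has leaves
    ([rho_irr]).

    _Dimension 2._  The components are trees with a positive eigenvector of
    eigenvalue 2.  Such weights are affine functions along the unbranched arms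
    of the tree, and this determines its shape: the weights rule out that there
    is no branching vertex; if two branching vertices are joined by an arm, both
    inequalities of [branch_weight] are equalities and all other neighbours are
    leaves; a single branching vertex of degree 3 leads to the equation
    [1/A + 1/B + 1/C = 1] ([affine_component]).

    _Other dimensions._  Write [r] for the vertex of [rho] and [N] for its set of
    neighbours, the constituents of [rho (x) rho], each of multiplicity 1.  For
    distinct [i] and [j] in [N], a constituent of [i (x) j] is at distance at
    most 2 from both [i] and [j], which in a forest puts it in [N]
    ([fus_neighbour]).  Counting walks from [i] to [j] shows that
    [i (x) j^*] has exactly one constituent in [N] when [i] differs from [j].
    Together, [i (x) j^*] is a member of [N] as soon as [i] differs from both
    [j] and [j^*].  If [i] has maximal dimension in [N], all members of [N] but
    [i] and [i^*] are therefore linear ([neighbour_degree]).  Now [rho (x) rho]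
    is the sum of its symmetric and its alternating part, both self-dual, and
    [i] occurs in only one of them; hence the other part has only linear
    constituents ([linear_part]), and the derived subgroup acts on it trivially.
    For [d >= 3] a matrix that fixes all symmetric or all alternating forms is
    [1] or [-1] ([fixes_forms_scalar]), so the derived subgroup acts on [rho] by
    signs and on all of [rho (x) rho] trivially; for [d = 1] this is clear.  Two
    consequences finish the proof.  First, all members of [N] are linear, so
    vertices at distance 2 have equal dimensions, which together with the
    existence of a leaf makes every component a star with [d^2] leaves
    ([equal_weights_hedgehog]).  Second, the quotient of [G] by the scalars in
    [rho] is an elementary abelian 2-group of order [d^2], so [d^2] is a power
    of 4 ([scalar_comm_degree]).

    Since the eigenvalue [d] can be read off from a star component
    ([hedgehog_weight]), a star with [4 ^ n] leaves, [n <> 1], excludes [d = 2],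
    and all components are stars with [d^2] leaves. *)

Local Open Scope nat_scope.

(** * Forests *)

Definition acyclic (T : eqType) (a : rel T) : Prop :=
  forall p : seq T, uniq p -> 2 < size p -> ~~ path.cycle a p.

Section ForestDigraph.

Variable X : digraph.
Hypothesis forestX : undirected_forest X.

Lemma adjacentE (x y : X) : adjacent x y = (0 < edges x y).
Proof. by rewrite /adjacent forestX.1 orbb. Qed.

Lemma adjacent_sym : symmetric (@adjacent X).
Proof. by move=> x y; rewrite !adjacentE forestX.1. Qed.

Lemma adjacent_irr : irreflexive (@adjacent X).
Proof.
move=> x; apply/negP; rewrite adjacentE => exx.
by case/negP: (forestX.2 [:: (x, x, 0)]); rewrite /closed_path /= exx eqxx.
Qed.

Lemma edges_forest (x y : X) : edges x y = adjacent x y.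
Proof.
rewrite adjacentE; case e: (edges x y) => [|[|n]] //.
case/negP: (forestX.2 [:: (x, y, 0); (y, x, 1)]).
rewrite /closed_path /= [edges y x]forestX.1 e !eqxx /=.
by rewrite inE xpair_eqE andbF.
Qed.

(** A simple cycle becomes a closed path by following every vertex to its
    successor.  Two steps could only share an undirected edge if the cycle
    consisted of two vertices. *)
Lemma adjacent_acyclic : acyclic (@adjacent X).
Proof.
move=> p uniq_p size_p; apply/negP => cyc_p.
case/negP: (forestX.2 [seq (x, next p x, 0) | x <- p]).
apply/and4P; split.
- by case: (p) size_p.
- apply/allP => _ /mapP[x px ->] /=.
  by rewrite -adjacentE (next_cycle cyc_p).
- by rewrite cycle_map; apply: cycle_next.
rewrite -map_comp map_inj_in_uniq // => x y px py [/setP eq_xy].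
apply/eqP; case: (eqVneq x y) => // neq_xy.
have := eq_xy x; rewrite !inE eqxx (negPf neq_xy) /= => /esym/eqP x_eq.
have := eq_xy y; rewrite !inE eqxx eq_sym (negPf neq_xy) /= => /eqP y_eq.
have [i q def_p] := rot_to px.
have uniq_q : uniq (x :: q) by rewrite -def_p rot_uniq.
have size_q : 2 < size (x :: q) by rewrite -def_p size_rot.
move: x_eq y_eq; rewrite -!(next_rot i uniq_p) def_p.
case: q uniq_q size_q {def_p} => [|z [|t q]] //=.
rewrite !inE !negb_or => /andP[/and3P[nxz nxt _] /andP[/andP[nzt _] _]] _.
rewrite eqxx => x_def y_def; move: x_def.
rewrite y_def eq_sym (negPf nxz) eqxx => x_def.
by rewrite x_def eqxx in nxt.
Qed.

End ForestDigraph.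

(** * Non-backtracking walks *)

Section Walks.

Variables (T : finType) (a : rel T).
Hypotheses (asym : symmetric a) (airr : irreflexive a) (acyc : acyclic a).

(** The walk is at [y], which it reached from [x] and may not leave towards
    [x]; whether [x] and [y] are adjacent is left to the caller, so that the
    recursion is structural. *)
Fixpoint nbwalk (x y : T) (p : seq T) : bool :=
  if p is z :: q then [&& a y z, z != x & nbwalk y z q] else true.

Lemma nbwalk_path x y p : nbwalk x y p -> path a y p.
Proof.
by elim: p x y => //= z q IHq x y /and3P[-> _ /IHq].
Qed.

Lemma adj_neq x y : a x y -> x != y.
Proof. by move=> axy; apply: contraTneq axy => ->; rewrite airr. Qed.

(** The first return of such a walk to its starting point would close a cycle;
    by induction its tail does not repeat a vertex either. *)
Lemma nbwalk_uniq x y p : a x y -> nbwalk x y p -> uniq [:: x, y & p].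
Proof.
elim: p x y => [|z q IHq] x y axy nb; first by rewrite /= inE adj_neq.
have path_zq := nbwalk_path nb; have /and3P[ayz zx {}nb] := nb.
have uniq_yzq := IHq _ _ ayz nb.
rewrite cons_uniq uniq_yzq andbT.
rewrite !inE !negb_or [x == z]eq_sym zx adj_neq //=; apply/negP => xq.
case/splitPr: xq path_zq uniq_yzq nb => q1 q2 path_q uniq_q _.
have uniq_c : uniq [:: x, y, z & q1].
  move: uniq_q; rewrite -[_ :: _ :: _]/([:: y, z & q1] ++ x :: q2) -cat_rcons.
  by rewrite cat_uniq rcons_uniq => /andP[].
apply: (negP (acyc uniq_c isT)).
move: path_q; rewrite /= rcons_path cat_path /= axy ayz /=.
by case/and3P=> -> -> _.
Qed.

(** A walk that never turns back and could always be continued would have to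
    repeat a vertex; hence a forest has leaves. *)
Lemma leaf_exists x0 y0 :
  a x0 y0 -> exists y z, [/\ connect a x0 y, a y z & forall w, a y w -> w = z].
Proof.
move=> axy0.
suff: exists y z, [&& connect a x0 y, a y z & [forall w, a y w ==> (w == z)]].
  case=> y [z /and3P[h1 h2 /forallP h]]; exists y, z; split=> // w ayw.
  by apply/eqP; apply: implyP (h w) ayw.
case: (boolP [exists y, exists z,
         [&& connect a x0 y, a y z & [forall w, a y w ==> (w == z)]]]).
  by move=> /existsP[y /existsP[z h]]; exists y, z.
move=> noleaf; exfalso.
have ext y z : connect a x0 y -> a y z -> exists2 w, a y w & w != z.
  move=> cy ayz; move/existsP: noleaf => noleaf.
  have [w /andP[ayw nwz]|h] := pickP [pred w | a y w && (w != z)].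
    by exists w.
  case: noleaf; exists y; apply/existsP; exists z; rewrite cy ayz /=.
  by apply/forallP => w; move: (h w) => /=; case: (a y w) => //= /negbFE.
have long n : exists x y p,
    [/\ connect a x0 x, a x y, nbwalk x y p & size p = n].
  elim: n => [|n [x [y [p [cx axy nb sp]]]]].
    by exists x0, y0, [::]; rewrite connect0.
  have [w axw nwy] := ext x y cx axy.
  exists w, x, (y :: p); split; rewrite /= ?sp //; last 1 first.
  - by rewrite axy eq_sym nwy.
  - exact: connect_trans cx (connect1 axw).
  - by rewrite asym.
have [x [y [p [_ axy nb sp]]]] := long #|T|.
have := nbwalk_uniq axy nb => /card_uniqP /= card_xyp.
by have := max_card [in [:: x, y & p]]; rewrite card_xyp sp; lia.
Qed.

(** * Arms *)

Definition ends_leaf (x y : T) : Prop := forall w, a y w -> w = x.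

Definition ends_branch (x y : T) : Prop :=
  exists w1 w2, [/\ a y w1, a y w2 & uniq [:: x; w1; w2]].

(** The last vertex is left unconstrained, so that an arm can end in a leaf or
    in a branching vertex, or be continued. *)
Fixpoint arm (x y : T) (p : seq T) : Prop :=
  if p is z :: q
  then [/\ a y z, z != x, forall w, a y w -> w = x \/ w = z & arm y z q]
  else True.

Lemma arm_nbwalk x y p : arm x y p -> nbwalk x y p.
Proof.
by elim: p x y => //= z q IHq x y [-> -> _ /IHq].
Qed.

(** Continue as long as there is no choice; an arm is a walk without
    repetitions, so this stops after at most [#|T|] steps. *)
Lemma arm_exists x y : a x y ->
  exists2 p, arm x y p & let x' := last x (belast y p) in
    ends_leaf x' (last y p) \/ ends_branch x' (last y p).
Proof.
move=> axy.
suff long : forall n x y, a x y ->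
    (exists2 p, arm x y p & let x' := last x (belast y p) in
      ends_leaf x' (last y p) \/ ends_branch x' (last y p)) \/
    exists p, arm x y p /\ size p = n.
  have [//|[p [arm_p size_p]]] := long #|T| x y axy.
  have := nbwalk_uniq axy (arm_nbwalk arm_p) => /card_uniqP /= card_xyp.
  by have := max_card [in [:: x, y & p]]; rewrite card_xyp size_p; lia.
elim=> [|n IHn] {axy}x {}y axy; first by right; exists [::].
have [z /andP[ayz zx]|leaf] := pickP [pred z | a y z && (z != x)]; last first.
  left; exists [::] => //=; left=> w ayw; apply/eqP.
  by move: (leaf w) => /=; rewrite ayw /= => /negbFE.
have [w /and3P[ayw wx wz]|two] := pickP [pred w | [&& a y w, w != x & w != z]].
  left; exists [::] => //=; right; exists z, w; split=> //=.
  by rewrite !inE !negb_or ![x == _]eq_sym [z == w]eq_sym zx wx wz.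
have armP q : arm y z q -> arm x y (z :: q).
  move=> arm_q; split=> // w ayw; move: (two w) => /=; rewrite ayw /=.
  by case: eqP => [|_ /negbFE/eqP]; auto.
have [[q arm_q end_q]|[q [arm_q size_q]]] := IHn y z ayz.
  by left; exists (z :: q); [apply: armP | ].
by right; exists (z :: q); split; [apply: armP | rewrite /= size_q].
Qed.

End Walks.

(** * Weights *)

Section Weights.

Variables (T : finType) (a : rel T).
Hypotheses (asym : symmetric a) (airr : irreflexive a) (acyc : acyclic a).

Lemma nbwalk_rcons x y p z :
  nbwalk a x y (rcons p z) =
  [&& nbwalk a x y p, a (last y p) z & z != last x (belast y p)].
Proof.
elim: p x y => [|t p IHp] x y /=; first by rewrite andbT.
by rewrite IHp !andbA.
Qed.

(** Two walks leaving [x] in different directions form a single one, which runs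
    through the first walk backwards. *)
Lemma nbwalk_catrev_uniq x y p t :
  a x y -> nbwalk a x y p -> nbwalk a y x t -> uniq (catrev p [:: y, x & t]).
Proof.
elim: p x y t => [|z p IHp] x y t axy /=.
  by move=> _ /(nbwalk_uniq airr acyc); apply; rewrite asym.
case/and3P=> ayz zx nb_p nb_t; apply: (IHp y z (x :: t)) => //=.
by rewrite asym axy eq_sym zx.
Qed.

Lemma nbwalk_disjoint x y p y' p' :
  a x y -> nbwalk a x y p -> a x y' -> nbwalk a x y' p' -> y != y' ->
  ~~ has [in y :: p] (y' :: p').
Proof.
move=> axy nb axy' nb' neq.
have uniq_c : uniq (catrev p [:: y, x, y' & p']).
  by apply: nbwalk_catrev_uniq; rewrite //= axy' eq_sym neq.
move: uniq_c; rewrite catrevE cat_uniq => /and3P[_ /hasPn dis uniq_t].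
apply/negP => /hasP[w w_in' w_in]; move: w_in; rewrite inE => /orP[/eqP w_y|w_in].
  by move: uniq_t; rewrite cons_uniq inE -w_y w_in' orbT.
have: w \in [:: y, x, y' & p'] by rewrite !inE in w_in' *; rewrite w_in' !orbT.
by move/dis; rewrite /= mem_rev w_in.
Qed.

Lemma arm_neighbour d x y p i w : arm a x y p -> i < size p ->
  a (nth d (y :: p) i) w ->
  w = nth d [:: x, y & p] i \/ w = nth d (y :: p) i.+1.
Proof.
elim: p x y i => [|z p IHp] x y i //= [_ _ two arm_p] lt_i.
by case: i lt_i => [_ /two //|i /= lt_i]; apply: (IHp y z i).
Qed.

Variable v : T -> nat.
Hypothesis v_gt0 : forall x, 0 < v x.

(** Inequalities between weights become statements on the graph through the
    case of equality: the neighbours that have been left out have positive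
    weight. *)
Lemma neighbour_sum x s : uniq s -> all (a x) s ->
  \sum_(y <- s) v y <= \sum_(y | a x y) v y ?= iff [forall (w | a x w), w \in s].
Proof.
move=> uniq_s /allP a_s; rewrite [X in leqif _ X _](bigID (fun y => y \in s)) /=.
have -> : \sum_(y | a x y && (y \in s)) v y = \sum_(y <- s) v y.
  by rewrite big_uniq //; apply: eq_bigl => y; rewrite andb_idl // => /a_s.
split; first exact: leq_addr.
rewrite -[X in X == _]addn0 eqn_add2l eq_sym sum_nat_eq0.
apply: eq_forallb => w; rewrite eqn0Ngt v_gt0.
by case: (a x w); case: (w \in s).
Qed.

Hypothesis v2 : forall x, 2 * v x = \sum_(y | a x y) v y.

Lemma neighbour_weight x y : a x y -> v y <= 2 * v x.
Proof.
move=> axy; have [] := @neighbour_sum x [:: y] isT; first by rewrite /= axy.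
by rewrite big_seq1 -v2.
Qed.

Lemma leaf_weight x y : a y x -> 2 * v y = v x -> ends_leaf a x y.
Proof.
move=> ayx v_eq w ayw; have [] := @neighbour_sum y [:: x] isT.
  by rewrite /= ayx.
rewrite big_seq1 -v2 v_eq eqxx => _ /esym/forall_inP/(_ w ayw).
by rewrite inE => /eqP.
Qed.

Lemma end_weight x y : a y x -> ends_leaf a x y -> 2 * v y = v x.
Proof.
move=> ayx leaf; rewrite v2 (bigD1 x) //= big1 ?addn0 // => w.
by case/andP=> /leaf ->; rewrite eqxx.
Qed.

(** A vertex with two neighbours carries their mean weight: along an arm the
    weights form an arithmetic progression. *)
Lemma arm_weight x y z :
  a y x -> a y z -> z != x -> (forall w, a y w -> w = x \/ w = z) ->
  2 * v y = v x + v z.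
Proof.
move=> ayx ayz zx two; rewrite v2 (bigD1 x) //= (bigD1 z) /= ?ayz //.
by rewrite big1 ?addn0 // => w /andP[/andP[/two[]-> ]]; rewrite ?eqxx.
Qed.

(** The progression of weights would reach 0 one step beyond the leaf. *)
Lemma arm_leaf_weight x y p : a x y -> arm a x y p ->
  ends_leaf a (last x (belast y p)) (last y p) ->
  (size p).+2 * v y = (size p).+1 * v x.
Proof.
elim: p x y => [|z p IHp] x y axy /=.
  by rewrite mul1n => _ leaf; rewrite (end_weight _ leaf) // asym.
case=> ayz zx two arm_p leaf; have := IHp _ _ ayz arm_p leaf.
have := arm_weight _ ayz zx two; rewrite asym => /(_ axy); nia.
Qed.

(** The first and the last step of an arithmetic progression are equal. *)
Lemma arm_branch_weight x y p : a x y -> arm a x y p ->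
  v y + v (last x (belast y p)) = v x + v (last y p).
Proof.
elim: p x y => [|z p IHp] x y axy /=; first by rewrite addnC.
case=> ayz zx two arm_p; have := IHp _ _ ayz arm_p.
have := arm_weight _ ayz zx two; rewrite asym => /(_ axy); lia.
Qed.

(** Each of [w1] and [w2] weighs at least half as much as [y], which leaves at
    most [v y] for [x]; equality means that nothing else is adjacent to [y],
    [w1] or [w2].  At both ends of an arm joining two branching vertices the
    inequalities go in opposite directions along the progression of weights, so
    they are equalities. *)
Lemma branch_weight x y w1 w2 :
  a y x -> a y w1 -> a y w2 -> uniq [:: x; w1; w2] ->
  v x <= v y /\ (v x = v y ->
    [/\ forall w, a y w -> w \in [:: x; w1; w2],
        ends_leaf a y w1 & ends_leaf a y w2]).
Proof.
move=> ayx ayw1 ayw2 uniq_w.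
have := @neighbour_sum y [:: x; w1; w2] uniq_w.
rewrite ![all _ _]/= ayx ayw1 ayw2 !big_cons big_nil -v2 addn0.
move=> /(_ isT)[le_s eq_s].
have w1y : a w1 y by rewrite asym.
have w2y : a w2 y by rewrite asym.
have := neighbour_weight w1y; have := neighbour_weight w2y => le2 le1.
split; first lia.
move=> eq_v; split; try by apply: leaf_weight => //; lia.
by apply/forall_inP; rewrite -eq_s; apply/eqP; lia.
Qed.

(** Each neighbour weighs at least half as much as [x], and together they weigh
    twice as much. *)
Lemma four_weight x w1 w2 w3 w4 :
  all (a x) [:: w1; w2; w3; w4] -> uniq [:: w1; w2; w3; w4] ->
  (forall w, a x w -> w \in [:: w1; w2; w3; w4]) /\
  forall w, a x w -> ends_leaf a x w.
Proof.
move=> all_w uniq_w; have [le_s eq_s] := neighbour_sum uniq_w all_w.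
move: all_w => /= /and5P[xw1 xw2 xw3 xw4 _].
have le w : a x w -> v x <= 2 * v w.
  by move=> xw; apply: neighbour_weight; rewrite asym.
have := (le _ xw1, le _ xw2, le _ xw3, le _ xw4) => -[[[le1 le2] le3] le4].
move: le_s eq_s; rewrite !big_cons big_nil -v2 addn0 => le_s eq_s.
have nbrs : forall w, a x w -> w \in [:: w1; w2; w3; w4].
  by apply/forall_inP; rewrite -eq_s; apply/eqP; lia.
split=> // w xw; apply: leaf_weight; first by rewrite asym.
by have := nbrs w xw; rewrite !inE => /or4P[] /eqP ->; lia.
Qed.

End Weights.

(** * Recognizing components *)

Lemma graph_iso_sym (X Y : digraph) : graph_iso X Y -> graph_iso Y X.
Proof.
case=> f [g fK gK] fE; exists g; first by exists f.
by move=> x y; rewrite -fE !gK.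
Qed.

Lemma graph_iso_trans (X Y Z : digraph) :
  graph_iso X Y -> graph_iso Y Z -> graph_iso X Z.
Proof.
case=> f bij_f fE [g bij_g gE]; exists (g \o f); first exact: bij_comp.
by move=> x y; rewrite /= gE fE.
Qed.

Lemma uniq_ends (T : eqType) (s : seq T) (w1 w2 u1 u2 : T) :
  w1 != w2 -> u1 != u2 ->
  uniq (w1 :: rcons s u1) -> uniq (w1 :: rcons s u2) ->
  uniq (w2 :: rcons s u1) -> uniq (w2 :: rcons s u2) ->
  uniq ([:: w1; w2] ++ s ++ [:: u1; u2]).
Proof.
move=> nw nu; rewrite !cons_uniq cat_uniq !rcons_uniq !mem_rcons !inE !negb_or.
case/and3P=> /andP[n11 w1s] u1s us /and3P[/andP[n12 _] u2s _].
case/and3P=> /andP[n21 w2s] _ _ /and3P[/andP[n22 _] _ _].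
rewrite !mem_cat (negPf w1s) (negPf w2s) /= !inE !negb_or /= nw n11 n12 n21 n22.
by rewrite us u1s u2s nu.
Qed.

Section Components.

Variable X : digraph.
Hypothesis forestX : undirected_forest X.
Local Notation a := (@adjacent X).
Let asym := adjacent_sym forestX.
Let airr := adjacent_irr forestX.
Let acyc := adjacent_acyclic forestX.

(** The image of [f] is closed under adjacency, so it exhausts the component;
    that [f] reflects edges follows from the covering condition and
    injectivity. *)
Lemma component_iso (S : finType) (r : rel S) (f : S -> X) (s0 : S) (x : X) :
  injective f -> (forall s, connect a x (f s)) ->
  (forall s t, r s t -> a (f s) (f t)) ->
  (forall s y, a (f s) y -> exists2 t, y = f t & r s t || r t s) ->
  graph_iso (component x) (simple_graph r).
Proof.
move=> f_inj conn_f f_hom f_cover.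
have f_conn s y : connect a (f s) y -> exists t, y = f t.
  case/connectP=> p; elim: p s => [|z p IHp] s /=; first by exists s.
  by case/andP=> /f_cover[t -> _] /IHp.
apply: graph_iso_sym.
pose h s : component x := exist _ (f s) (conn_f s).
have h_onto (y : component x) : exists t, h t = y.
  have: connect a (f s0) (val y).
    apply: connect_trans (valP y).
    by rewrite (sym_connect_sym asym) conn_f.
  by case/f_conn=> t y_t; exists t; apply: val_inj.
exists h => [|s t].
  pose g y := odflt s0 [pick t | h t == y].
  exists g => [s|y]; rewrite /g; case: pickP => [t /eqP|no_t] //=.
  - by move/(congr1 val)/f_inj.
  - by have := no_t s; rewrite /= eqxx.
  by have [t /eqP] := h_onto y; rewrite no_t.
rewrite /= (edges_forest forestX); congr (nat_of_bool _).
apply/idP/idP => [/f_cover[t' /f_inj <-] //|/orP[]/f_hom //].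
by rewrite asym.
Qed.

Lemma hedgehog_iso (x c : X) : connect a x c ->
  (forall y, a c y -> ends_leaf a c y) ->
  graph_iso (component x) (hedgehog #|[pred y | a c y]|).
Proof.
move=> conn_c leaf.
pose f (s : option 'I_#|[pred y | a c y]|) := if s is Some i then enum_val i else c.
have cf i : a c (f (Some i)) by have := enum_valP i; rewrite inE.
apply: (component_iso (f := f) None).
- move=> [i|] [j|] //= => [/enum_val_inj -> //|eq_c|eq_c].
    by have := cf i; rewrite /= eq_c airr.
  by have := cf j; rewrite /= -eq_c airr.
- case=> [i|] //; apply: connect_trans conn_c (connect1 (cf i)).
- by case=> [i|] [j|] //= _; apply: cf.
case=> [i|] y /=; first by move/(leaf _ (cf i)) => ->; exists None.
move=> cy; exists (Some (enum_rank_in (cy : y \in [pred y | a c y]) y)) => //=.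
by rewrite enum_rankK_in.
Qed.

Lemma arm_connect x y p : a x y -> arm a x y p ->
  forall z, z \in [:: x, y & p] -> connect a x z.
Proof.
move=> axy /arm_nbwalk/nbwalk_path path_p z z_in.
by apply: (@path_connect _ a x (y :: p)); rewrite //= axy.
Qed.

Lemma arm_adjacent d x y p i : a x y -> arm a x y p -> i <= size p ->
  a (nth d [:: x, y & p] i) (nth d (y :: p) i).
Proof.
move=> axy /arm_nbwalk/nbwalk_path path_p lt_i.
by have /pathP/(_ i lt_i) : path a x (y :: p) by rewrite /= axy.
Qed.

(** The position, in the list of vertices formed by two leaves, a path and two
    leaves, of a vertex of the affine diagram of type D. *)
Definition affineD_index n (s : affineD n) : nat :=
  match s with
  | inl i => i.+2
  | inr (b, e) => (if b then (n - 3).+2 else 0) + e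
  end.

Lemma affineD_index_lt n (t : affineD n) : affineD_index t < (n - 3) + 4.
Proof. by case: t => [[i lt_i]|[[] []]] /=; lia. Qed.

Lemma affineD_index_inj n : injective (@affineD_index n).
Proof.
case=> [[i lt_i]|[[] []]] [[j lt_j]|[[] []]] //= e; try by [lia | case: e].
by congr inl; apply: val_inj; case: e.
Qed.

(** The vertices form the list [w1, w2, c, y, ..., l, u1, u2], with [l] the last
    vertex of the arm.  It has no repetitions: leaving out one of [w1], [w2] and
    one of [u1], [u2] yields a walk without returns. *)
Lemma affineD_iso (x c y : X) (p : seq X) (w1 w2 u1 u2 : X) :
  connect a x c -> a c y -> arm a c y p ->
  uniq [:: y; w1; w2] ->
  (forall w, a c w = (w \in [:: y; w1; w2])) ->
  ends_leaf a c w1 -> ends_leaf a c w2 ->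
  uniq [:: last c (belast y p); u1; u2] ->
  (forall w, a (last y p) w = (w \in [:: last c (belast y p); u1; u2])) ->
  ends_leaf a (last y p) u1 -> ends_leaf a (last y p) u2 ->
  graph_iso (component x) (affineD (size p + 5)).
Proof.
move=> conn_c cy arm_p uniq_w c_nbrs leaf1 leaf2 uniq_u l_nbrs leaf3 leaf4.
set l := last y p in l_nbrs leaf3 leaf4 *.
set l' := last c _ in uniq_u l_nbrs.
set n := size p + 5; set s := [:: c, y & p].
pose L := [:: w1; w2] ++ s ++ [:: u1; u2].
have def_n : n - 3 = size s by rewrite /n -addnBA // addn2.
have def_n4 : n - 4 = (size p).+1 by rewrite /n -addnBA // addn1.
have def_n5 : n - 5 = size p by rewrite /n addnK.
have nb_p := arm_nbwalk arm_p.
move: uniq_w; rewrite /= !inE !negb_or => /and3P[/andP[nyw1 nyw2] nw12 _].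
move: uniq_u; rewrite /= !inE !negb_or => /and3P[/andP[nlu1 nlu2] nu12 _].
have cw1 : a c w1 by rewrite c_nbrs !inE eqxx orbT.
have cw2 : a c w2 by rewrite c_nbrs !inE eqxx !orbT.
have lu1 : a l u1 by rewrite l_nbrs !inE eqxx orbT.
have lu2 : a l u2 by rewrite l_nbrs !inE eqxx !orbT.
have uniq_wu w u : w \in [:: w1; w2] -> u \in [:: u1; u2] ->
    uniq (w :: rcons s u).
  move=> w_in u_in; apply: (nbwalk_uniq airr acyc).
    by rewrite asym; move: w_in; rewrite !inE => /orP[]/eqP->.
  rewrite /= cy nbwalk_rcons nb_p /=.
  by move: w_in u_in; rewrite !inE => /orP[]/eqP-> /orP[]/eqP->;
     rewrite ?nyw1 ?nyw2 ?lu1 ?lu2 eq_sym ?nlu1 ?nlu2.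
have uniq_L : uniq L.
  have in1 : w1 \in [:: w1; w2] by rewrite inE eqxx.
  have in2 : w2 \in [:: w1; w2] by rewrite !inE eqxx orbT.
  have in3 : u1 \in [:: u1; u2] by rewrite inE eqxx.
  have in4 : u2 \in [:: u1; u2] by rewrite !inE eqxx orbT.
  by apply: uniq_ends; rewrite ?uniq_wu.
pose f (t : affineD n) := nth c L (affineD_index t).
have fP i : i < size s -> nth c L i.+2 = nth c s i.
  move=> lt_i; rewrite -[LHS]/(nth c (s ++ [:: u1; u2]) i).
  by rewrite nth_cat lt_i.
have fL (i : 'I_(n - 3)) : f (inl i) = nth c s i.
  by apply: fP; rewrite -def_n.
have fF b e : f (inr (b, e)) =
    if b then (if e then u2 else u1) else (if e then w2 else w1).
  rewrite /f /affineD_index; case: b; last by case: e.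
  rewrite -[LHS]/(nth c (s ++ [:: u1; u2]) ((n - 3) + e)).
  by rewrite nth_cat def_n ltnNge leq_addr addKn; case: e.
have s_last : nth c s (n - 4) = l.
  by rewrite def_n4 /s /l -[last y p]/(last c (y :: p)) (last_nth c).
have s_l' : nth c s (n - 5) = l'.
  rewrite def_n5 /l' /s; case/lastP: (p) => [|q z] //=.
  rewrite belast_rcons size_rcons -[LHS]/(nth c (rcons (y :: q) z) (size q)).
  by rewrite nth_rcons ltnSn -last_nth.
have adj_s i : i.+1 < size s -> a (nth c s i) (nth c s i.+1).
  by move=> lt_i; apply: (arm_adjacent c cy arm_p).
have conn_s i : connect a x (nth c s i).
  case: (ltnP i (size s)) => [lt_i|/(nth_default c) -> //].
  by apply: connect_trans conn_c (arm_connect cy arm_p _); rewrite mem_nth.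
have nbr_s i w : i < size s -> a (nth c s i) w ->
    [\/ i = 0 /\ w \in [:: w1; w2], i = n - 4 /\ w \in [:: u1; u2],
        exists2 j, i = j.+1 & w = nth c s j | i.+1 < size s /\ w = nth c s i.+1].
  case: i => [|i] lt_i.
    rewrite /= c_nbrs in_cons => /orP[/eqP ->|]; last by constructor 1.
    by constructor 4.
  move=> adj_w; case: (ltnP i (size p)) => lt_ip.
    have [->|->] := arm_neighbour arm_p lt_ip adj_w.
      by constructor 3; exists i.
    by constructor 4.
  have def_i : i = n - 5 by apply/eqP; rewrite def_n5 eqn_leq lt_ip andbT.
  have i_n4 : i.+1 = n - 4 by rewrite def_n4 def_i def_n5.
  move: adj_w; rewrite i_n4 s_last l_nbrs in_cons => /orP[/eqP ->|].
    by constructor 3; exists i; rewrite // -s_l' def_i.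
  by constructor 2.
apply: (component_iso (f := f) (inr (false, false))).
- move=> t t' /eqP; rewrite (nth_uniq c _ _ uniq_L); last 2 first.
  + by have := affineD_index_lt t; rewrite def_n addn4 /= size_cat addn2.
  + by have := affineD_index_lt t'; rewrite def_n addn4 /= size_cat addn2.
  by move/eqP/affineD_index_inj.
- case=> [i|[b e]]; first by rewrite fL.
  have conn_l : connect a x l by rewrite -s_last.
  rewrite fF; case: b; [apply: (connect_trans conn_l)
    | apply: (connect_trans conn_c)]; by apply: connect1; case: e.
- case=> [i|[b e]] [j|[b' e']] //.
    by move=> /eqP ij; rewrite !fL ij; apply: adj_s; rewrite -def_n -ij.
  rewrite fL fF; case: b' => /eqP ->; first by rewrite s_last; case: e'.
  by case: e'.
have n4 : n - 4 < n - 3 by rewrite def_n def_n4.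
have n0 : 0 < n - 3 by rewrite def_n.
case=> [i|[b e]] w.
  have lt_i : i < size s by rewrite -def_n.
  rewrite fL => /(nbr_s _ _ lt_i)[[i0 w_in]|[i4 w_in]|[j i_j ->]|[lt_i1 ->]].
  - exists (inr (false, w == w2)); last by rewrite i0 eqxx.
    by rewrite fF; move: w_in; rewrite !inE; case: (eqVneq w w2) => [->//|_];
       rewrite orbF => /eqP.
  - exists (inr (true, w == u2)); last by rewrite i4 eqxx.
    by rewrite fF; move: w_in; rewrite !inE; case: (eqVneq w u2) => [->//|_];
       rewrite orbF => /eqP.
  - have lt_j : j < n - 3 by rewrite def_n (ltn_trans _ lt_i) ?i_j.
    by exists (inl (Ordinal lt_j)); rewrite ?fL //= i_j eqxx orbT.
  have lt_i1' : i.+1 < n - 3 by apply: leq_trans lt_i1 _; rewrite def_n.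
  by exists (inl (Ordinal lt_i1')); rewrite ?fL //= eqxx.
rewrite fF; case: b => adj_w.
  exists (inl (Ordinal n4)); last by rewrite /= eqxx.
  by rewrite fL s_last; case: e adj_w => [/leaf4|/leaf3].
exists (inl (Ordinal n0)); last by rewrite /= eqxx.
by rewrite fL; case: e adj_w => [/leaf2|/leaf1].
Qed.

End Components.

Section Stars.

Variable X : digraph.
Hypothesis forestX : undirected_forest X.
Local Notation a := (@adjacent X).
Let asym := adjacent_sym forestX.
Let airr := adjacent_irr forestX.
Let acyc := adjacent_acyclic forestX.

Definition leaf_arm (c : X) (s : seq X) : Prop :=
  if s is y :: p
  then [/\ a c y, arm a c y p & ends_leaf a (last c (belast y p)) (last y p)]
  else False.

Lemma leaf_arm_uniq c s : leaf_arm c s -> uniq (c :: s).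
Proof.
case: s => // y p [cy arm_p _].
exact: nbwalk_uniq airr acyc _ _ _ cy (arm_nbwalk arm_p).
Qed.

Lemma leaf_arm_neighbour c s i w : leaf_arm c s -> i < size s ->
  a (nth c s i) w ->
  w = nth c (c :: s) i \/ i.+1 < size s /\ w = nth c s i.+1.
Proof.
case: s => // y p [cy arm_p leaf]; rewrite [size _]/= ltnS leq_eqVlt.
case/orP=> [/eqP ->|lt_i]; last first.
  by case/(arm_neighbour arm_p lt_i) => ->; [left | right].
have -> : nth c (y :: p) (size p) = last y p by rewrite -last_nth.
move/leaf => ->; left; case/lastP: (p) => [|q z] //.
rewrite belast_rcons size_rcons -[RHS]/(nth c (rcons (y :: q) z) (size q)).
by rewrite nth_rcons ltnSn -last_nth.
Qed.

(** Arms starting at different neighbours of [c] are disjoint because two walks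
    leaving [c] in different directions are. *)
Lemma starlike_iso (x c : X) (L : seq (seq X)) :
  connect a x c -> (forall s, s \in L -> leaf_arm c s) ->
  uniq [seq head c s | s <- L] ->
  (forall w, a c w -> w \in [seq head c s | s <- L]) ->
  graph_iso (component x) (starlike [seq size s | s <- L]).
Proof.
move=> conn_c arm_L uniq_h c_nbrs.
pose s (k : 'I_(size [seq size s | s <- L])) := nth [::] L k.
have lt_k (k : 'I_(size [seq size s | s <- L])) : k < size L.
  by have := ltn_ord k; rewrite [X in _ < X]size_map.
have arm_s k : leaf_arm c (s k) by apply: arm_L; rewrite mem_nth.
have size_s (k : 'I_(size [seq size s | s <- L])) :
    nth 0 [seq size s | s <- L] k = size (s k).
  by rewrite (nth_map [::]).
have head_s k : a c (head c (s k)).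
  by have := arm_s k; case: (s k) => [|y p] // [].
have disj k k' : k != k' -> ~~ has [in s k] (s k').
  move=> neq; have := arm_s k; have := arm_s k'.
  case E': (s k') => [|y' p'] // [cy' arm_p' _].
  case E: (s k) => [|y p] // [cy arm_p _].
  apply: (nbwalk_disjoint asym airr acyc cy (arm_nbwalk arm_p)
            cy' (arm_nbwalk arm_p')).
  have -> : y = nth c [seq head c s | s <- L] k.
    by rewrite (nth_map [::]) // -/(s k) E.
  have -> : y' = nth c [seq head c s | s <- L] k'.
    by rewrite (nth_map [::]) // -/(s k') E'.
  by rewrite nth_uniq // [size [seq head c s | s <- L]]size_map lt_k.
pose f (t : starlike [seq size s | s <- L]) : X :=
  if t is Some u then nth c (s (tag u)) (tagged u) else c.
have lt_u (u : {k : 'I_(size [seq size s | s <- L]) &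
                'I_(nth 0 [seq size s | s <- L] k)}) :
    tagged u < size (s (tag u)).
  by rewrite -size_s.
have f_in u : f (Some u) \in s (tag u) by apply: mem_nth.
have c_notin k : c \notin s k by have /andP[] := leaf_arm_uniq (arm_s k).
have vertexP k i : i < size (s k) -> exists2 u, f (Some u) = nth c (s k) i &
    tag u = k /\ tagged u = i :> nat.
  rewrite -size_s => lt_i.
  by exists (existT (fun k : 'I_(size [seq size s | s <- L]) =>
    'I_(nth 0 [seq size s | s <- L] k)) k (Ordinal lt_i)).
apply: (component_iso forestX (f := f) None).
- move=> [u|] [u'|] // eq_f; last 2 first.
  + by have := f_in u; rewrite eq_f (negPf (c_notin _)).
  + by have := f_in u'; rewrite -eq_f (negPf (c_notin _)).
  have eq_tag : tag u = tag u'.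
    apply/eqP; apply: contraT => /disj/hasPn/(_ _ (f_in u')).
    by rewrite -eq_f /= f_in.
  case: u u' eq_tag eq_f => [k i] [k' j] /= eq_k.
  rewrite -{}eq_k in j *; rewrite /f /= => /eqP.
  rewrite nth_uniq -?size_s //; last first.
    by have /andP[] := leaf_arm_uniq (arm_s k).
  by move/eqP/val_inj => ->.
- case=> [u|] //; apply: connect_trans conn_c _.
  have := f_in u; have := arm_s (tag u).
  case: (s (tag u)) => [|y p] // [cy arm_p _] u_in.
  by apply: (arm_connect cy arm_p); rewrite inE u_in orbT.
- case=> [u|] [u'|] //.
    case/andP=> /eqP eq_k /eqP ij; have := lt_u u'.
    have := arm_s (tag u); rewrite /f ij -eq_k.
    case: (s _) => [|y p] //= [cy arm_p _] lt_j.
    exact: (arm_adjacent (i := (tagged u).+1) c cy arm_p).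
  by move/eqP => /= j0; rewrite /f /= j0 nth0.
case=> [u|] w; last first.
  move=> /c_nbrs/(nthP c)[k ltk <-].
  have ltk' : k < size [seq size s | s <- L] by move: ltk; rewrite !size_map.
  have s_gt0 : 0 < size (s (Ordinal ltk')).
    by have := arm_s (Ordinal ltk'); case: (s _).
  have [v fv [_ v0]] := vertexP _ _ s_gt0.
  exists (Some v); last by rewrite v0.
  by rewrite fv nth0 (nth_map [::]) // -(size_map (head c)).
case/(leaf_arm_neighbour (arm_s _) (lt_u u)) => [->|[lt_u1 ->]].
  case u0: (nat_of_ord (tagged u)) => [|i].
    by exists None; rewrite // u0.
  have lt_i : i < size (s (tag u)).
    by apply: leq_trans (lt_u u); rewrite u0.
  have [v fv [kv iv]] := vertexP _ _ lt_i; exists (Some v); first by rewrite fv.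
  by rewrite iv kv !eqxx orbT.
have [v fv [kv iv]] := vertexP _ _ lt_u1; exists (Some v); first by rewrite fv.
by rewrite iv kv !eqxx.
Qed.

Variable v : X -> nat.
Hypothesis v_gt0 : forall x, 0 < v x.
Hypothesis v2 : forall x, 2 * v x = \sum_(y | a x y) v y.

Lemma leaf_arm_weight c s : leaf_arm c s ->
  (size s).+1 * v (head c s) = size s * v c.
Proof.
by case: s => // y p [cy arm_p leaf]; apply: (arm_leaf_weight asym).
Qed.

(** The hypotheses amount to [1/(A+1) + 1/(B+1) + 1/(C+1) = 1].  The
    complements [V - t1], [V - t2], [V - t3] are [V] times these fractions; they
    decrease and have sum [V], which bounds [A] by 2 and, for [A = 1], [B] by
    3. *)
Lemma three_arms (A B C V t1 t2 t3 : nat) :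
  0 < V -> A <= B -> B <= C ->
  A.+1 * t1 = A * V -> B.+1 * t2 = B * V -> C.+1 * t3 = C * V ->
  t1 + t2 + t3 = 2 * V ->
  [\/ [/\ A = 2, B = 2 & C = 2], [/\ A = 1, B = 3 & C = 3]
    | [/\ A = 1, B = 2 & C = 5]].
Proof.
move=> V_gt0 AB BC e1 e2 e3 sum_t.
have coweight D t : D.+1 * t = D * V -> exists2 u, t + u = V & D.+1 * u = V.
  by move=> e; exists (V - t); nia.
have [u1 sum1 f1] := coweight _ _ e1.
have [u2 sum2 f2] := coweight _ _ e2.
have [u3 sum3 f3] := coweight _ _ e3.
have {sum_t sum1 sum2 sum3 e1 e2 e3 coweight} sum_u : u1 + u2 + u3 = V by lia.
have pos D u : D.+1 * u = V -> 0 < u.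
  by case: u => // e; rewrite muln0 in e; rewrite -e in V_gt0.
have anti D E u w : D.+1 * u = V -> E.+1 * w = V -> D <= E -> w <= u.
  move=> eu ew le_DE; rewrite -(leq_pmul2l (ltn0Sn D)) eu -ew.
  by rewrite leq_mul2r ltnS le_DE orbT.
have u21 := anti _ _ _ _ f1 f2 AB; have u32 := anti _ _ _ _ f2 f3 BC.
have u3_gt0 := pos _ _ f3; have {pos} u2_gt0 := pos _ _ f2.
have cancel3 D n : D.+1 * u3 = n * u3 -> D.+1 = n.
  by move/eqP; rewrite eqn_pmul2r // => /eqP.
move: {anti} f1; case: A AB => [|[|A]] AB f1; first lia; last first.
  have A_0 : A = 0 by apply/eqP; rewrite -leqn0; nia.
  subst A; have eq3 : V = 3 * u3 by lia.
  have eq2 : u2 = u3 by lia.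
  have [] : C.+1 = 3 /\ B.+1 = 3 by split; apply: cancel3; lia.
  by move=> [->] [->]; constructor 1.
have eqV : V = 2 * u2 + 2 * u3 by lia.
have B_le3 : B <= 3.
  rewrite -ltnS -(leq_pmul2r u2_gt0) f2; lia.
case: B AB {B_le3} (B_le3) f2 BC => [|[|[|[|B]]]] // _ _ f2 BC; first lia.
  have eq2 : u2 = 2 * u3 by lia.
  have [->] : C.+1 = 6 by apply: cancel3; lia.
  by constructor 3.
have eq2 : u2 = u3 by lia.
have [->] : C.+1 = 4 by apply: cancel3; lia.
by constructor 2.
Qed.

End Stars.

Section AffineComponents.

Variable X : digraph.
Hypothesis forestX : undirected_forest X.
Local Notation a := (@adjacent X).
Let asym := adjacent_sym forestX.
Let airr := adjacent_irr forestX.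
Let acyc := adjacent_acyclic forestX.

Variable v : X -> nat.
Hypothesis v_gt0 : forall x, 0 < v x.
Hypothesis v2 : forall x, 2 * v x = \sum_(y | a x y) v y.

Lemma arm_last_adjacent x y p : a x y -> arm a x y p ->
  a (last x (belast y p)) (last y p).
Proof.
by elim: p x y => [|z p IHp] x y axy //= [ayz _ _]; apply: IHp.
Qed.

Lemma arm_last_connect x y p : a x y -> arm a x y p -> connect a x (last y p).
Proof.
move=> axy arm_p; apply: (arm_connect axy arm_p).
by rewrite inE mem_last orbT.
Qed.

(** Going along the arm, weights do not increase at its beginning and do not
    decrease at its end; being an arithmetic progression they are constant, and
    [branch_weight] describes both ends. *)
Lemma branch_arm_component (x c y : X) p w1 w2 :
  connect a x c -> a c y -> a c w1 -> a c w2 -> uniq [:: y; w1; w2] ->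
  arm a c y p -> ends_branch a (last c (belast y p)) (last y p) ->
  exists2 n, 4 <= n & graph_iso (component x) (affineD n).
Proof.
move=> conn_c cy cw1 cw2 uniq_w arm_p [u1 [u2 [lu1 lu2 uniq_u]]].
exists (size p + 5); first by rewrite addnC.
have ll' : a (last y p) (last c (belast y p)).
  by rewrite asym (arm_last_adjacent cy arm_p).
have [le1 eq1] := branch_weight asym v_gt0 v2 cy cw1 cw2 uniq_w.
have [le2 eq2] := branch_weight asym v_gt0 v2 ll' lu1 lu2 uniq_u.
have eq_v := arm_branch_weight asym v2 cy arm_p.
have [|nbrs1 leaf1 leaf2] := eq1; first lia.
have [|nbrs2 leaf3 leaf4] := eq2; first lia.
apply: (affineD_iso forestX conn_c cy arm_p uniq_w _ leaf1 leaf2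
          uniq_u _ leaf3 leaf4) => w.
  apply/idP/idP; first exact: nbrs1.
  by rewrite !inE => /or3P[]/eqP->.
apply/idP/idP; first exact: nbrs2.
by rewrite !inE => /or3P[]/eqP->.
Qed.

Lemma star_component (x c : X) (L : seq (seq X)) :
  connect a x c -> size L = 3 -> (forall s, s \in L -> leaf_arm c s) ->
  uniq [seq head c s | s <- L] ->
  (forall w, a c w -> w \in [seq head c s | s <- L]) ->
  exists2 n, n \in [:: 6; 7; 8] & graph_iso (component x) (affineE n).
Proof.
move=> conn_c size_L arm_L uniq_L c_nbrs.
pose shorter := relpre (@size X) leq.
have /permPl perm_L := perm_sort shorter L.
(* [three_arms] assumes that the arms are listed by increasing length. *)
have sorted_L : sorted shorter (sort shorter L).
  by apply: sort_sorted => s t; apply: leq_total.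
have perm_h := perm_map (head c) perm_L.
have {}arm_L s : s \in sort shorter L -> leaf_arm c s.
  by rewrite (perm_mem perm_L); apply: arm_L.
have {}c_nbrs w : a c w -> w \in [seq head c s | s <- sort shorter L].
  by rewrite (perm_mem perm_h); apply: c_nbrs.
rewrite -(perm_uniq perm_h) in uniq_L; rewrite -(perm_size perm_L) in size_L.
move: (sort shorter L) size_L sorted_L arm_L c_nbrs uniq_L {perm_L perm_h}.
case=> [|s1 [|s2 [|s3 [|s4 l]]]] // _ /and3P[le12 le23 _] arm_L c_nbrs uniq_L.
have adj_h s : s \in [:: s1; s2; s3] -> a c (head c s).
  by move/arm_L; case: s => // y p [].
have wt s : s \in [:: s1; s2; s3] -> (size s).+1 * v (head c s) = size s * v c.
  by move/arm_L/(leaf_arm_weight forestX v2).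
have in1 : s1 \in [:: s1; s2; s3] by rewrite !inE eqxx.
have in2 : s2 \in [:: s1; s2; s3] by rewrite !inE eqxx orbT.
have in3 : s3 \in [:: s1; s2; s3] by rewrite !inE eqxx !orbT.
have all_h : all (a c) [seq head c s | s <- [:: s1; s2; s3]].
  by apply/allP => _ /mapP[s s_in ->]; apply: adj_h.
have [_ sum_h] := neighbour_sum v_gt0 uniq_L all_h.
have := introT forall_inP c_nbrs; rewrite -sum_h -v2 /= {sum_h}.
rewrite !big_cons big_nil addn0 addnA => /eqP sum_h.
have iso := starlike_iso forestX conn_c arm_L uniq_L c_nbrs.
have := three_arms (v_gt0 c) le12 le23 (wt _ in1) (wt _ in2) (wt _ in3) sum_h.
by case=> -[/= e1 e2 e3]; [exists 6 | exists 7 | exists 8] => //;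
   move: iso; rewrite /= e1 e2 e3.
Qed.

(** Start at a leaf [y]: the arm from [y] cannot end in a leaf, since weights
    increase along it from [v y] to [2 * v y] and further.  So it leads to a
    branching vertex [c], from which the component is explored. *)
Lemma affine_component (x : X) :
  [\/ exists2 n, 4 <= n & graph_iso (component x) (affineD n),
     exists2 n, n \in [:: 6; 7; 8] & graph_iso (component x) (affineE n)
   | graph_iso (component x) (hedgehog 4)].
Proof.
have [y0 xy0] : exists y, a x y.
  have [y xy|none] := pickP (a x); first by exists y.
  by have := v_gt0 x; have := v2 x; rewrite big_pred0 //; lia.
have [y [z [conn_y yz leaf]]] := leaf_exists asym airr acyc xy0.
have zy : a z y by rewrite asym.
have [p arm_p [leaf'|[w1 [w2 [cw1 cw2 uniq_w]]]]] := arm_exists airr acyc yz.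
  have := arm_leaf_weight asym v2 yz arm_p leaf'.
  by have := end_weight v2 yz leaf; have := v_gt0 y; nia.
have {conn_y} conn_c := connect_trans conn_y (arm_last_connect yz arm_p).
have {arm_p} := arm_last_adjacent yz arm_p; rewrite asym.
move: (last y _) (last z p) conn_c cw1 cw2 uniq_w => w3 c conn_c cw1 cw2.
move=> uniq_w cw3 {y z yz zy leaf p y0 xy0}.
have [w4 /andP[cw4 w4_new]|only3] :=
    pickP [pred w | a c w && (w \notin [:: w3; w1; w2])].
  have uniq_4 : uniq [:: w4; w3; w1; w2] by rewrite cons_uniq w4_new.
  have all_4 : all (a c) [:: w4; w3; w1; w2] by rewrite /= cw1 cw2 cw3 cw4.
  have [nbrs leaf] := four_weight asym v_gt0 v2 all_4 uniq_4.
  constructor 3; have := hedgehog_iso forestX conn_c leaf.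
  suff -> : #|[pred y | a c y]| = 4 by [].
  apply: etrans (card_uniqP uniq_4); apply: eq_card => w; rewrite inE.
  by apply/idP/idP => [/nbrs //|]; apply/allP.
have c_nbrs w : a c w -> w \in [:: w3; w1; w2].
  by move=> cw; have := only3 w; rewrite /= cw /= => /negbFE.
have [p1 arm1 end1] := arm_exists airr acyc cw1.
have [p2 arm2 end2] := arm_exists airr acyc cw2.
have [p3 arm3 end3] := arm_exists airr acyc cw3.
have rot1 : uniq [:: w1; w2; w3] by have := uniq_w; rewrite -(rot_uniq 1).
have rot2 : uniq [:: w2; w3; w1] by have := uniq_w; rewrite -(rot_uniq 2).
case: end3 => [leaf3|branch]; last first.
  by constructor 1; apply: (branch_arm_component conn_c cw3 cw1 cw2 uniq_w arm3).
case: end1 => [leaf1|branch]; last first.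
  by constructor 1; apply: (branch_arm_component conn_c cw1 cw2 cw3 rot1 arm1).
case: end2 => [leaf2|branch]; last first.
  by constructor 1; apply: (branch_arm_component conn_c cw2 cw3 cw1 rot2 arm2).
constructor 2.
apply: (@star_component x c [:: w3 :: p3; w1 :: p1; w2 :: p2]) => //.
by move=> s; rewrite !inE => /or3P[]/eqP ->.
Qed.

End AffineComponents.

Section Hedgehogs.

Variable X : digraph.
Hypothesis forestX : undirected_forest X.
Local Notation a := (@adjacent X).
Let asym := adjacent_sym forestX.
Let airr := adjacent_irr forestX.
Let acyc := adjacent_acyclic forestX.

Variables (d : nat) (v : X -> nat).
Hypothesis d_gt0 : 0 < d.
Hypothesis v_gt0 : forall x, 0 < v x.
Hypothesis vd : forall x, d * v x = \sum_(y | a x y) v y.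

Lemma weight_neighbour_exists x : exists y, a x y.
Proof.
have [y xy|none] := pickP (a x); first by exists y.
have := vd x; rewrite big_pred0 // => /eqP; rewrite muln_eq0 -!leqn0.
by rewrite leqNgt d_gt0 leqNgt v_gt0.
Qed.

(** Take a leaf [y] and its neighbour [z], so [v z = d * v y].  All neighbours
    [t] of [z] have the weight of [y], so the equation at [t] is used up by [z]
    alone and [t] is a leaf; the equation at [z] then counts the leaves. *)
Lemma equal_weights_hedgehog (x : X) :
  (forall z y y', a z y -> a z y' -> v y = v y') ->
  graph_iso (component x) (hedgehog (d * d)).
Proof.
move=> eq_v; have [y0 xy0] := weight_neighbour_exists x.
have [y [z [conn_y yz leaf]]] := leaf_exists asym airr acyc xy0.
have zy : a z y by rewrite asym.
have vz : v z = d * v y.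
  rewrite vd (bigD1 z) //= big1 ?addn0 // => w.
  by case/andP=> /leaf ->; rewrite eqxx.
have nbrs_leaf t : a z t -> ends_leaf a z t.
  move=> zt w tw; apply/eqP; apply: contraT => wz.
  have := vd t; rewrite (eq_v z t y) // -vz (bigD1 z) /= 1?asym //.
  rewrite (bigD1 w) /=; last by rewrite tw.
  by have := v_gt0 w; lia.
have conn_z := connect_trans conn_y (connect1 yz).
suff <- : #|[pred t | a z t]| = d * d by apply: hedgehog_iso.
apply/eqP; rewrite -(eqn_pmul2r (v_gt0 y)) -mulnA -vz vd.
rewrite (eq_bigr (fun=> v y)) => [|t zt]; last exact: eq_v zt zy.
by rewrite sum_nat_const.
Qed.

(** With a centre of weight [c] and leaves of weight [l], the equations are
    [d * l = c] at a leaf and [d * c = m * l] at the centre. *)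
Lemma hedgehog_weight (x : X) (m : nat) :
  graph_iso (component x) (hedgehog m) -> m = d * d.
Proof.
case=> f [g fK gK] f_edges.
have g_adj s t : a (val (g s)) (val (g t)) = edges s t :> nat.
  by rewrite -(edges_forest forestX) -{2}(gK s) -{2}(gK t) f_edges.
have g_nbr s y : a (val (g s)) y -> exists t, y = val (g t).
  move=> sy; have conn_y : connect a x y.
    exact: connect_trans (valP (g s)) (connect1 sy).
  by exists (f (exist _ y conn_y)); rewrite fK.
pose c := val (g None); pose h i := val (g (Some i)).
have ch i : a c (h i) by have := g_adj None (Some i); case: (a _ _).
have h_inj : injective h by move=> i j /val_inj/(can_inj gK)[].
have c_nbrs y : a c y = (y \in codom h).
  apply/idP/codomP => [cy|[i ->] //].
  have [[i|] y_t] := g_nbr _ _ cy; first by exists i.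
  by rewrite y_t airr in cy.
have h_weight i : d * v (h i) = v c.
  rewrite vd (bigD1 c) /= 1?asym // big1 ?addn0 // => y /andP[hy y_c].
  have [[j|] y_t] := g_nbr _ _ hy; last by rewrite y_t eqxx in y_c.
  by have := g_adj (Some i) (Some j); rewrite -y_t hy.
have sum_h : \sum_(y | a c y) v y = \sum_i v (h i).
  have uniq_h : uniq (codom h) by rewrite codomE map_inj_uniq // enum_uniq.
  rewrite (eq_bigl _ _ c_nbrs) -(big_uniq _ uniq_h) codomE.
  by rewrite [LHS](big_map h predT v) big_enum.
apply/eqP; rewrite -(eqn_pmul2r (v_gt0 c)) -mulnA vd sum_h big_distrr /=.
by rewrite (eq_bigr _ (fun i _ => h_weight i)) sum_nat_const card_ord.
Qed.

End Hedgehogs.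

Import GroupScope GRing.Theory Num.Theory.
Local Open Scope ring_scope.

(** * Characters over an algebraically closed field of characteristic 0 *)

Lemma mxtrace_lin_mx (F : fieldType) (m n : nat)
    (f : {linear 'M[F]_(m, n) -> 'M[F]_(m, n)}) :
  \tr (lin_mx f) = \sum_i \sum_j f (delta_mx i j) i j.
Proof.
rewrite /mxtrace (reindex _ (curry_mxvec_bij m n)) /= pair_bigA.
by apply: eq_bigr => -[i j] _ /=; rewrite mxE /= vec_mx_delta mxvecE.
Qed.

Lemma mulmx_delta_mulE (F : fieldType) (m n p q : nat) (A : 'M[F]_(m, n))
    (B : 'M[F]_(p, q)) i j k l :
  (A *m delta_mx k l *m B) i j = A i k * B l j.
Proof.
rewrite mxE (bigD1 l) //= big1 ?addr0 => [|x nxl]; last first.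
  rewrite mxE big1 ?mul0r // => y _.
  by rewrite mxE (negPf nxl) andbF mulr0.
rewrite mxE (bigD1 k) //= big1 ?addr0 => [|y nyk]; last first.
  by rewrite mxE (negPf nyk) mulr0.
by rewrite mxE !eqxx mulr1.
Qed.

Lemma idempotent_factor (F : fieldType) (n : nat) (P : 'M[F]_n) :
  P *m P = P -> row_base P *m col_base P = 1%:M.
Proof.
have /row_full_inj colI := col_base_full P.
have /row_free_inj rowI := row_base_free P.
move: (col_base P) (row_base P) colI rowI (mulmx_base P) => B C colI rowI BC PP.
by apply: colI; apply: rowI; rewrite mulmx1 -!mulmxA BC mulmxA BC.
Qed.

Lemma idempotent_rank (F : fieldType) (n : nat) (P : 'M[F]_n) :
  P *m P = P -> \tr P = (\rank P)%:R.
Proof.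
move=> /idempotent_factor rc; rewrite -{1}(mulmx_base P) mxtrace_mulC.
by rewrite rc mxtrace1.
Qed.

(** The dimension is the rank, hence the trace, of the projection [f] onto [U];
    the sum on the right is this trace in the basis of elementary matrices. *)
Lemma dim_idempotent_image (F : fieldType) (m n : nat)
    (f : {linear 'M[F]_(m, n) -> 'M[F]_(m, n)}) (U : {vspace 'M[F]_(m, n)}) :
  (forall A, f A \in U) -> {in U, forall A, f A = A} ->
  (\dim U)%:R = \sum_i \sum_j f (delta_mx i j) i j :> F.
Proof.
move=> fU fid; rewrite -mxtrace_lin_mx idempotent_rank; last first.
  apply/row_matrixP=> i; rewrite !rowE mulmxA !mul_rV_lin /= mxvecK.
  by rewrite fid.
congr (_%:R); set P := lin_mx f.
pose X := [tuple vec_mx (row i (row_base P)) | i < \rank P].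
have memU u : (vec_mx u \in U) = (u <= row_base P)%MS.
  rewrite eq_row_base; apply/idP/idP => [uU|/submxP[w ->]].
    apply/submxP; exists u; rewrite mul_rV_lin /= fid // vec_mxK //.
  by rewrite mul_rV_lin /= mxvecK.
have freeX : free X.
  apply/freeP=> k; rewrite (eq_bigr (fun i =>
      vec_mx (k i *: row i (row_base P)))); last first.
    by move=> i _; rewrite (nth_map i) ?size_enum_ord // nth_ord_enum linearZ.
  rewrite -linear_sum => e i; have {e} e0 := congr1 mxvec e.
  rewrite vec_mxK linear0 in e0.
  have: (\row_i k i) *m row_base P = 0 *m row_base P.
    rewrite mulmx_sum_row mul0mx -[RHS]e0.
    by apply: eq_bigr => j _; rewrite mxE.
  by move/(row_free_inj (row_base_free P)) => /rowP/(_ i); rewrite !mxE.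
have -> : U = <<X>>%VS.
  apply/eqP; rewrite eqEsubv; apply/andP; split; apply/subvP => A.
    rewrite -[A]mxvecK memU => /submxP[w ->].
    rewrite mulmx_sum_row linear_sum memv_suml // => i _.
    rewrite linearZ memvZ // memv_span //.
    by apply/tnthP; exists i; rewrite tnth_mktuple.
  move: A; apply/subvP/span_subvP => A /tnthP[i ->].
  by rewrite tnth_mktuple memU row_sub.
by move: freeX; rewrite /free => /eqP ->; rewrite size_tuple.
Qed.

Section Characters.

Variables (F : numClosedFieldType) (gT : finGroupType) (G : {group gT}).
Local Notation reprG := (mx_representation F G).
Local Notation chi i := (fun g => \tr (irr_repr i g)).

Definition ch n (V : reprG n) : gT -> F := fun g => \tr (V g).

Definition cdot (f h : gT -> F) : F :=
  #|G|%:R^-1 * \sum_(g in G) f g^-1%g * h g.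

Definition multiplicity n (V : reprG n) (i : Irr F G) : nat :=
  \dim (hom_repr V (irr_repr i)).

Lemma natG_neq0 : #|G|%:R != 0 :> F.
Proof. by rewrite pnatr_eq0 -lt0n cardG_gt0. Qed.

Lemma pcharG : [pchar F]^'.-group G.
Proof. by rewrite /pgroup pcharf'_nat natG_neq0. Qed.

Lemma splitG : group_splitting_field F G.
Proof. exact: group_closure_closed_field. Qed.

Definition avg m n (V : reprG m) (W : reprG n) (f : 'M[F]_(m, n)) :=
  #|G|%:R^-1 *: \sum_(g in G) V g^-1%g *m f *m W g.

Lemma avg_linear m n (V : reprG m) (W : reprG n) : linear (avg V W).
Proof.
move=> a A B; rewrite /avg [a *: (_ *: _)]scalerA [a * _]mulrC -scalerA.
rewrite -scalerDr; congr (_ *: _); rewrite scaler_sumr -big_split /=.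
apply: eq_bigr => g _.
by rewrite mulmxDr mulmxDl -scalemxAr -scalemxAl.
Qed.

HB.instance Definition _ m n V W :=
  GRing.isSemilinear.Build F _ _ _ (@avg m n V W)
    (GRing.semilinear_linear (@avg_linear m n V W)).

(** Averaging over [G] projects all matrices onto the homomorphisms. *)
Lemma dim_hom m n (V : reprG m) (W : reprG n) :
  (\dim (hom_repr V W))%:R = cdot (ch V) (ch W).
Proof.
rewrite (@dim_idempotent_image _ _ _ (avg V W)).
- rewrite /avg /cdot; under eq_bigr => i _.
    under eq_bigr => j _.
      rewrite mxE summxE.
      under eq_bigr => g _ do rewrite mulmx_delta_mulE.
      over.
    rewrite -mulr_sumr exchange_big /=.
    over.
  rewrite /= -mulr_sumr exchange_big /=; congr (_ * _).
  apply: eq_bigr => g _; rewrite /ch /mxtrace mulr_suml.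
  by apply: eq_bigr => i _; rewrite mulr_sumr.
- move=> A; apply/memv_hom_repr => h Gh; rewrite /avg.
  rewrite -scalemxAr -scalemxAl; congr (_ *: _).
  rewrite mulmx_sumr mulmx_suml (reindex_acts 'R _ Gh) ?astabsR //=.
  apply: eq_bigr => g Gg; rewrite !mulmxA -repr_mxM ?groupV ?groupM //.
  by rewrite invMg mulKVg repr_mxM // !mulmxA.
move=> A /memv_hom_repr homA; rewrite /= /avg.
rewrite (eq_bigr (fun=> A)) => [|g Gg]; last first.
  by rewrite -mulmxA -homA // mulmxA -repr_mxM ?groupV // mulVg repr_mx1 mul1mx.
by rewrite sumr_const -scaler_nat scalerA mulVf ?natG_neq0 // scale1r.
Qed.

Lemma eq_cdot f1 f2 h1 h2 :
  {in G, f1 =1 f2} -> {in G, h1 =1 h2} -> cdot f1 h1 = cdot f2 h2.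
Proof.
move=> ef eh; rewrite /cdot; congr (_ * _); apply: eq_bigr => g Gg.
by rewrite ef ?groupV // eh.
Qed.

Lemma cdot_sumr (I : finType) f (h : I -> gT -> F) (a : I -> F) :
  cdot f (fun g => \sum_i a i * h i g) = \sum_i a i * cdot f (h i).
Proof.
rewrite /cdot mulr_sumr; under eq_bigr do rewrite mulr_sumr mulr_sumr.
rewrite exchange_big; apply: eq_bigr => i _ /=.
rewrite !mulr_sumr; apply: eq_bigr => g _.
by rewrite [RHS]mulrCA [a i * (f _ * _)]mulrCA.
Qed.

Lemma cdotC f h : cdot f h = cdot h f.
Proof.
rewrite /cdot; congr (_ * _); rewrite (reindex_inj invg_inj) /=.
by apply: eq_big => g; rewrite ?groupV // invgK mulrC.
Qed.

Lemma cdot_suml (I : finType) f (h : I -> gT -> F) (a : I -> F) :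
  cdot (fun g => \sum_i a i * h i g) f = \sum_i a i * cdot (h i) f.
Proof. by rewrite cdotC cdot_sumr; under eq_bigr do rewrite cdotC. Qed.

Lemma hom_irr_rsim m n (V : reprG m) (W : reprG n) :
  mx_irreducible V -> mx_irreducible W -> (0 < \dim (hom_repr V W))%N ->
  mx_rsim V W.
Proof.
move=> irrV irrW; rewrite lt0n dimv_eq0 => nz.
pose f := vpick (hom_repr V W).
have nzf : f != 0 by rewrite vpick0.
have /memv_hom_repr homf : f \in hom_repr V W by apply: memv_pick.
have freef : row_free f.
  rewrite -kermx_eq0; apply: contraNT nzf => nzk.
  case/mx_irrP: irrV => _ /(_ (kermx f)).
  rewrite nzk => /(_ _ isT) fk; rewrite -mxrank_eq0 -[f]mul1mx.
  have /sub_kermxP -> : (1%:M <= kermx f)%MS.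
    rewrite sub1mx; apply: fk; apply/mxmoduleP => g Gg; apply/sub_kermxP.
    by rewrite -mulmxA homf // mulmxA mulmx_ker mul0mx.
  by rewrite mxrank0.
have fullf : row_full f.
  case/mx_irrP: irrW => _ /(_ <<f>>%MS).
  rewrite /row_full genmxE; apply; last by rewrite -mxrank_eq0 genmxE mxrank_eq0.
  rewrite (eqmx_module _ (genmxE _)); apply/mxmoduleP => g Gg.
  by rewrite -homf // submxMl.
exists f => //.
by move: freef fullf; rewrite /row_free /row_full => /eqP -> /eqP.
Qed.

Lemma irr_irr (i : Irr F G) : mx_irreducible (irr_repr i).
Proof. exact: socle_irr. Qed.

Lemma dim_end_irr n (V : reprG n) :
  mx_irreducible V -> \dim (hom_repr V V) = 1%N.
Proof.
move=> irrV; suff -> : hom_repr V V = <[1%:M]>%VS.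
  rewrite dim_vline -mxrank_eq0 mxrank1.
  by case/mx_irrP: irrV => + _; case: (n).
apply/vspaceP => A; apply/idP/vlineP => [/memv_hom_repr homA | [a ->]].
  have /is_scalar_mxP[a ->] : is_scalar_mx A.
    apply: (mx_abs_irr_cent_scalar (splitG irrV)).
    by apply/centgmxP => g Gg; rewrite homA.
  by exists a; rewrite scalemx1.
apply/memv_hom_repr => g _.
by rewrite -scalemxAl -scalemxAr mulmx1 mul1mx.
Qed.

Lemma cdot_irr (i j : Irr F G) : cdot (chi i) (chi j) = (i == j)%:R.
Proof.
rewrite -(dim_hom (irr_repr i) (irr_repr j)).
have [<-|neq_ij] := eqVneq i j; first by rewrite dim_end_irr //; apply: irr_irr.
congr _%:R; apply: contraNeq neq_ij; rewrite -lt0n => h.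
exact/socle_rsimP/(hom_irr_rsim (irr_irr i) (irr_irr j) h).
Qed.

(** Split off irreducible submodules by Maschke's theorem; each of them is a
    component of the regular representation. *)
Lemma ch_decomp n (V : reprG n) :
  exists a : Irr F G -> nat, {in G, ch V =1 fun g => \sum_i (a i)%:R * chi i g}.
Proof.
have [m lenm] := ubnP n; elim: m n lenm V => [|m IHm] // n /ltnSE lenm V.
have [n0|n_gt0] := posnP n.
  exists (fun=> 0%N) => g _; rewrite big1 => [|i _]; last by rewrite mul0r.
  by rewrite /ch /mxtrace big1 //; case=> i lti; exfalso; rewrite n0 in lti.
have modV : mxmodule V 1%:M by apply: mxmodule1.
have [|U simU _] := dec_mxsimple_exists modV.
  by rewrite -mxrank_eq0 mxrank1 -lt0n.
have [modU nzU _] := simU.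
have [W modW defW dxW] := mx_Maschke_pchar V pcharG modU (submx1 U).
have rU : (0 < \rank U)%N by rewrite lt0n mxrank_eq0.
have rW : (\rank W < m)%N.
  apply: leq_trans lenm; rewrite -[X in (_ < X)%N](mxrank1 F n) -defW.
  by rewrite (mxdirectP dxW) /= -[X in (X < _)%N]add0n ltn_add2r.
have [a eqa] := IHm _ rW (submod_repr modW).
have irrU : mx_irreducible (submod_repr modU) by apply/submod_mx_irr.
pose i0 : Irr F G := irr_comp (Irr F G) (submod_repr modU).
exists (fun i => (i == i0) + a i)%N => g Gg.
rewrite /ch -(mxtrace_submod1 modV (eqmx_refl _)) //.
rewrite -(mxtrace_dadd_mod modU modW modV defW dxW) //.
under eq_bigr do rewrite natrD mulrDl.
rewrite big_split /=; congr (_ + _); last exact: eqa.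
rewrite (mxtrace_rsim (rsim_irr_comp_pchar (Irr F G) pcharG irrU)) //.
rewrite (bigD1 i0) //= eqxx mul1r big1 ?addr0 // => i /negPf ->.
by rewrite mul0r.
Qed.

Lemma ch_mult n (V : reprG n) :
  {in G, ch V =1 fun g => \sum_i (multiplicity V i)%:R * chi i g}.
Proof.
have [a eqa] := ch_decomp V; suff eq_am i : a i = multiplicity V i.
  by move=> g Gg; rewrite eqa //; under eq_bigr do rewrite eq_am.
apply/eqP; rewrite -(eqr_nat F) dim_hom (eq_cdot eqa (fun _ _ => erefl)).
rewrite cdot_suml (bigD1 i) //= cdot_irr eqxx mulr1 big1 ?addr0 // => j neq.
by rewrite cdot_irr (negPf neq) mulr0.
Qed.

End Characters.

(** * Multiplicities *)

Section Multiplicities.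

Variables (F : numClosedFieldType) (gT : finGroupType) (G : {group gT}).
Local Notation reprG := (mx_representation F G).
Local Notation chi i := (ch (irr_repr i)).
Implicit Types i j k : Irr F G.

Lemma multE n (V : reprG n) i : (multiplicity V i)%:R = cdot G (ch V) (chi i).
Proof. exact: dim_hom. Qed.

(** Multiplicities are linear in the character.  Identities between
    multiplicities are therefore obtained below from pointwise identities
    between characters. *)
Lemma mult_comb (I : finType) n (V : reprG n) (m : I -> nat)
    (W : forall x, reprG (m x)) (a : I -> nat) :
  {in G, ch V =1 fun g => \sum_x (a x)%:R * ch (W x) g} ->
  forall k, multiplicity V k = (\sum_x a x * multiplicity (W x) k)%N.
Proof.
move=> eqV k; apply/eqP; rewrite -(eqr_nat F) natr_sum multE.
rewrite (eq_cdot eqV (fun _ _ => erefl)) cdot_suml.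
by under [X in _ == X]eq_bigr do rewrite natrM multE.
Qed.

Lemma mult_ext m n (V : reprG m) (W : reprG n) :
  {in G, ch V =1 ch W} -> forall k, multiplicity V k = multiplicity W k.
Proof.
move=> eqVW k; apply/eqP; rewrite -(eqr_nat F) !multE.
by rewrite (eq_cdot eqVW (fun _ _ => erefl)).
Qed.

Lemma ch_ext m n (V : reprG m) (W : reprG n) :
  (forall k, multiplicity V k = multiplicity W k) -> {in G, ch V =1 ch W}.
Proof.
by move=> eqVW g Gg; rewrite !ch_mult //; under eq_bigr do rewrite eqVW.
Qed.

Lemma mult_irr i k : multiplicity (irr_repr i) k = (i == k).
Proof. by apply/eqP; rewrite -(eqr_nat F) multE cdot_irr. Qed.

Lemma cdot_ch m n (V : reprG m) (W : reprG n) :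
  cdot G (ch V) (ch W) = (\sum_i multiplicity V i * multiplicity W i)%:R.
Proof.
rewrite (eq_cdot (fun _ _ => erefl) (ch_mult W)) cdot_sumr natr_sum.
by apply: eq_bigr => i _; rewrite -multE -natrM mulnC.
Qed.

Lemma ch1 n (V : reprG n) : ch V 1%g = n%:R.
Proof. by rewrite /ch repr_mx1 mxtrace1. Qed.

Lemma sum_mult_degree n (V : reprG n) :
  (\sum_i multiplicity V i * irr_degree i)%N = n.
Proof.
apply/eqP; rewrite -(eqr_nat F) -(ch1 V) ch_mult // natr_sum.
by under eq_bigr do rewrite natrM -(ch1 (irr_repr _)).
Qed.

Lemma ch_prod m n (V : reprG m) (W : reprG n) g :
  ch (prod_repr V W) g = ch V g * ch W g.
Proof. exact: mxtrace_prod. Qed.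

Lemma ch_dual n (V : reprG n) g : ch (dual_repr V) g = ch V g^-1%g.
Proof. exact: mxtrace_tr. Qed.

Lemma mult_prodr m n (V : reprG m) (W : reprG n) k :
  multiplicity (prod_repr V W) k =
  (\sum_i multiplicity W i * multiplicity (prod_repr V (irr_repr i)) k)%N.
Proof.
apply: (mult_comb (W := fun i => prod_repr V (irr_repr i))) => g Gg.
rewrite ch_prod (ch_mult W) // mulr_sumr; apply: eq_bigr => i _.
by rewrite ch_prod mulrCA.
Qed.

Lemma mult_prodC m n (V : reprG m) (W : reprG n) k :
  multiplicity (prod_repr V W) k = multiplicity (prod_repr W V) k.
Proof. by apply: mult_ext => g _; rewrite !ch_prod mulrC. Qed.

Lemma mult_prodl m n (V : reprG m) (W : reprG n) k :
  multiplicity (prod_repr V W) k =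
  (\sum_i multiplicity V i * multiplicity (prod_repr (irr_repr i) W) k)%N.
Proof. by rewrite mult_prodC mult_prodr; under eq_bigr do rewrite mult_prodC. Qed.

Lemma mult_prodA l m n (U : reprG l) (V : reprG m) (W : reprG n) k :
  multiplicity (prod_repr (prod_repr U V) W) k =
  multiplicity (prod_repr U (prod_repr V W)) k.
Proof. by apply: mult_ext => g _; rewrite !ch_prod mulrA. Qed.

Lemma mult_adjoint l m n (U : reprG l) (V : reprG m) (W : reprG n) :
  (\sum_i multiplicity (prod_repr U V) i * multiplicity W i =
   \sum_i multiplicity U i * multiplicity (prod_repr (dual_repr V) W) i)%N.
Proof.
apply/eqP; rewrite -(eqr_nat F) -!cdot_ch; apply/eqP.
rewrite /cdot; congr (_ * _); apply: eq_bigr => g _.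
by rewrite !ch_prod ch_dual mulrA.
Qed.

Lemma sum_mult_irr n (V : reprG n) k :
  (\sum_i multiplicity V i * multiplicity (irr_repr k) i)%N = multiplicity V k.
Proof.
rewrite (bigD1 k) //= mult_irr eqxx muln1 big1 ?addn0 // => i.
by rewrite eq_sym mult_irr => /negPf ->; rewrite muln0.
Qed.

Lemma norm1_irr n (V : reprG n) :
  (\sum_i multiplicity V i * multiplicity V i)%N = 1%N ->
  exists k, forall i, multiplicity V i = (k == i).
Proof.
move=> norm1; have [k Vk|V0] := pickP (fun i => (0 < multiplicity V i)%N); last first.
  by move: norm1; rewrite big1 // => i _; have := V0 i; case: (multiplicity V i).
exists k => i; move: norm1; rewrite (bigD1 k) //=.
have [<-|nki] := eqVneq k i; first by nia.
rewrite (bigD1 i) 1?eq_sym //=; nia.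
Qed.

Lemma ch_irr n (V : reprG n) k :
  (forall i, multiplicity V i = (k == i)) -> {in G, ch V =1 chi k}.
Proof. by move=> eqV; apply: ch_ext => i; rewrite eqV mult_irr. Qed.

(** The norm of a character is invariant under [g |-> g^-1]. *)
Lemma dual_irr i : exists k, {in G, chi k =1 fun g => chi i g^-1%g}.
Proof.
have [|k eqk] := @norm1_irr _ (dual_repr (irr_repr i)).
  apply/eqP; rewrite -(eqr_nat F) -cdot_ch -[1%N]/(nat_of_bool true).
  rewrite -(eqxx i) -cdot_irr /cdot; apply/eqP; congr (_ * _).
  by apply: eq_bigr => g _; rewrite !ch_dual invgK mulrC.
by exists k => g Gg; rewrite -(ch_irr eqk) // ch_dual.
Qed.

(** * Linear constituents and the derived subgroup *)

Lemma hom_irr_full m (V : reprG m) k : (0 < multiplicity V k)%N ->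
  exists2 f : 'M[F]_(m, irr_degree k), row_full f &
    {in G, forall g, V g *m f = f *m irr_repr k g}.
Proof.
rewrite lt0n dimv_eq0 => nz; pose f := vpick (hom_repr V (irr_repr k)).
have nzf : f != 0 by rewrite vpick0.
have /memv_hom_repr homf : f \in hom_repr V (irr_repr k) by apply: memv_pick.
exists f => //; case/mx_irrP: (irr_irr k) => _ /(_ <<f>>%MS).
rewrite /row_full genmxE; apply; last by rewrite -mxrank_eq0 genmxE mxrank_eq0.
rewrite (eqmx_module _ (genmxE _)); apply/mxmoduleP => g Gg.
by rewrite -homf // submxMl.
Qed.

Lemma mult_rsim m (V : reprG m) k :
  (0 < multiplicity V k)%N -> m = irr_degree k -> mx_rsim V (irr_repr k).
Proof.
move=> /hom_irr_full[f fullf homf] eq_m; exists f => //.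
by rewrite /row_free (eqP fullf) eq_m.
Qed.

(** A nonzero homomorphism onto the constituent carries the trivial action of
    the derived subgroup over to it, and an irreducible representation of an
    abelian group over an algebraically closed field is linear. *)
Lemma linear_constituent m (V : reprG m) k :
  {in G^`(1)%g, forall g, V g = 1%:M} -> (0 < multiplicity V k)%N ->
  irr_degree k = 1%N.
Proof.
move=> V1 /hom_irr_full[f fullf homf]; apply/eqP.
rewrite -(der1_sub_rker (@splitG F _ G) (irr_irr k)); apply/subsetP => g G'g.
have Gg : g \in G by apply: subsetP (der_sub 1 G) g G'g.
apply/rkerP; split=> //; apply: (row_full_inj fullf).
by rewrite -homf // V1 // mul1mx mulmx1.
Qed.

Lemma linear_der1 k g : irr_degree k = 1%N -> g \in G^`(1)%g ->
  irr_repr k g = 1%:M.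
Proof.
by move=> k1 G'g; have /subsetP/(_ g G'g)/rkerP[] := rker_linear (irr_repr k) k1.
Qed.

(** The average of [V] over [G^`(1)] is a projection; its trace, hence its rank,
    is [n] if all constituents of [V] are linear. *)
Lemma trivial_on_der1 n (V : reprG n) :
  (forall k, (0 < multiplicity V k)%N -> irr_degree k = 1%N) ->
  {in G^`(1)%g, forall g, V g = 1%:M}.
Proof.
move=> lin; set K := G^`(1)%G; have sKG : K \subset G := der_sub 1 G.
have chK g : g \in K -> ch V g = n%:R.
  move=> Kg; have Gg := subsetP sKG g Kg.
  rewrite ch_mult // -[in RHS](sum_mult_degree V) natr_sum; apply: eq_bigr => k _.
  rewrite natrM; have [->|] := posnP (multiplicity V k); first by rewrite !mul0r.
  by move/lin=> k1; rewrite /ch linear_der1 // mxtrace1.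
have nzK : #|K|%:R != 0 :> F by rewrite pnatr_eq0 -lt0n cardG_gt0.
pose E := #|K|%:R^-1 *: \sum_(g in K) V g.
have VE h : h \in K -> V h *m E = E.
  move=> Kh; have Gh := subsetP sKG h Kh.
  rewrite -scalemxAr mulmx_sumr; congr (_ *: _).
  rewrite [RHS](reindex_inj (mulgI h)) /=.
  rewrite [RHS](eq_bigl [in K]) => [|g]; last by rewrite groupMl.
  by apply: eq_bigr => g Kg; rewrite repr_mxM // (subsetP sKG).
have EE : E *m E = E.
  rewrite {1}/E -scalemxAl mulmx_suml (eq_bigr _ VE) sumr_const -scaler_nat.
  by rewrite scalerA mulVf // scale1r.
have trE : \tr E = n%:R.
  rewrite linearZ /= raddf_sum /= (eq_bigr _ chK) sumr_const.
  by rewrite -[_ *+ #|_|]mulr_natl mulKf.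
have freeE : row_full E.
  by rewrite /row_full -(eqr_nat F) -idempotent_rank // trE.
have /row_fullP[B BE] := freeE.
have E1 : E = 1%:M by rewrite -[LHS]mul1mx -{1}BE -mulmxA EE.
by move=> g Kg; have := VE g Kg; rewrite E1 mulmx1.
Qed.

End Multiplicities.

(** * Symmetric and alternating forms *)

Section Forms.

Variables (F : numClosedFieldType) (gT : finGroupType) (G : {group gT}).
Local Notation reprG := (mx_representation F G).
Local Notation chi i := (ch (irr_repr i)).

(** Write [P = C B] with [B C = 1]: then [B V C] is the action on the image of
    [P]. *)
Lemma idempotent_repr n (V : reprG n) (P : 'M[F]_n) :
  P *m P = P -> {in G, forall g, P *m V g = V g *m P} ->
  exists r (W : reprG r), {in G, forall g, ch W g = \tr (V g *m P)} /\
    {in G, forall g, W g = 1%:M -> P *m V g = P}.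
Proof.
move=> PP PV; have [r [B [C [CB rc]]]] : exists r (B : 'M_(r, n)) (C : 'M_(n, r)),
    C *m B = P /\ B *m C = 1%:M.
  exists (\rank P), (row_base P), (col_base P).
  by split; [apply: mulmx_base | apply: idempotent_factor].
have BP : B *m P = B by rewrite -CB mulmxA rc mul1mx.
have PC : P *m C = C by rewrite -{1}CB -mulmxA rc mulmx1.
have W_repr : mx_repr G (fun g => B *m V g *m C).
  split=> [|g h Gg Gh]; first by rewrite repr_mx1 mulmx1.
  rewrite repr_mxM // -[in LHS]BP !mulmxA -(mulmxA B P) PV // !mulmxA.
  by rewrite -(mulmxA _ P) -CB !mulmxA.
exists r, (MxRepresentation W_repr); split=> g Gg /=.
  by rewrite /ch /= -mulmxA mxtrace_mulC -mulmxA CB.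
move=> W1; have -> : P *m V g = C *m (B *m V g *m C) *m B.
  by rewrite !mulmxA CB -(mulmxA _ C) CB -mulmxA -PV // mulmxA PP.
by rewrite W1 mulmx1.
Qed.

Variables (d : nat) (rho : reprG d).

Lemma form_mx_repr :
  mx_repr G (fun g => lin_mx (mulmxr (rho g) \o mulmx (rho g)^T)).
Proof.
split=> [|g h Gg Gh].
  apply/row_matrixP => i; rewrite !rowE mul_rV_lin /= repr_mx1 trmx1.
  by rewrite mul1mx mulmx1 vec_mxK mulmx1.
apply/row_matrixP => i; rewrite !rowE mulmxA !mul_rV_lin /= mxvecK.
by rewrite repr_mxM // trmx_mul !mulmxA.
Qed.

(** A model of [rho (x) rho] with matrices as vectors: exchanging the two factors
    is transposition. *)
Definition form_repr : reprG (d * d) := MxRepresentation form_mx_repr.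

Lemma ch_form g : ch form_repr g = ch rho g * ch rho g.
Proof.
rewrite /ch /= mxtrace_lin_mx /= /mxtrace mulr_suml; apply: eq_bigr => i _.
by rewrite mulr_sumr; apply: eq_bigr => j _; rewrite mulmx_delta_mulE mxE.
Qed.

(** The projection onto symmetric ([b = false]) or alternating ([b = true])
    matrices. *)
Definition sym_proj (b : bool) : 'M[F]_(d * d) :=
  2%:R^-1 *: (1%:M + (-1) ^+ b *: lin_mx trmx).

Lemma lin_trmxK : lin_mx trmx *m lin_mx trmx = 1%:M :> 'M[F]_(d * d).
Proof.
apply/row_matrixP => i; rewrite !rowE mulmxA !mul_rV_lin /= mxvecK trmxK.
by rewrite vec_mxK mulmx1.
Qed.

Lemma sym_proj_idem b : sym_proj b *m sym_proj b = sym_proj b.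
Proof.
rewrite /sym_proj; set U := _ *: lin_mx _.
have UU : U *m U = 1%:M.
  by rewrite -scalemxAl -scalemxAr lin_trmxK scalerA -signr_addb addbb scale1r.
rewrite -scalemxAl -scalemxAr mulmxDl !mulmxDr !mul1mx mulmx1 UU.
rewrite [U + _]addrC -mulr2n -scaler_nat !scalerA.
by rewrite mulVf ?mulr1 // pnatr_eq0.
Qed.

Lemma sym_projC b : {in G, forall g,
  sym_proj b *m form_repr g = form_repr g *m sym_proj b}.
Proof.
move=> g Gg; rewrite /sym_proj -scalemxAl -scalemxAr mulmxDl mulmxDr.
rewrite mul1mx mulmx1 -scalemxAl -scalemxAr; congr (_ *: (_ + _ *: _)).
apply/row_matrixP => i; rewrite !rowE !mulmxA !mul_rV_lin /= !mxvecK.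
by rewrite !trmx_mul trmxK mulmxA.
Qed.

Lemma mxtrace_form_sym (b : bool) g :
  \tr (form_repr g *m sym_proj b) =
  2%:R^-1 * (ch rho g ^+ 2 + (-1) ^+ b * \tr (rho g *m rho g)).
Proof.
rewrite -scalemxAr mulmxDr mulmx1 -scalemxAr linearZ linearD linearZ /=.
congr (_ * (_ + _ * _)); first exact: ch_form.
pose f : {linear 'M[F]_d -> 'M[F]_d} := trmx \o (mulmxr (rho g) \o mulmx (rho g)^T).
have -> : form_repr g *m lin_mx trmx = lin_mx f.
  by apply/row_matrixP => i; rewrite !rowE mulmxA !mul_rV_lin /= mxvecK.
rewrite mxtrace_lin_mx /mxtrace; apply: eq_bigr => i _; rewrite [RHS]mxE.
apply: eq_bigr => j _; rewrite /f /= mxE mulmx_delta_mulE mxE.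
by [].
Qed.

(** The symmetric and the alternating square of [rho].  The trace of
    [rho g *m rho g] is the value of the character at [g ^+ 2]. *)
Lemma sym_repr (b : bool) : exists r (W : reprG r),
  {in G, forall g, ch W g =
     2%:R^-1 * (ch rho g ^+ 2 + (-1) ^+ b * \tr (rho g *m rho g))} /\
  {in G, forall g, W g = 1%:M -> forall A : 'M[F]_d,
     A^T = (-1) ^+ b *: A -> (rho g)^T *m A *m rho g = A}.
Proof.
have [r [W [chW W1]]] := idempotent_repr (sym_proj_idem b) (@sym_projC b).
exists r, W; split=> g Gg; first by rewrite chW // mxtrace_form_sym.
move=> Wg A symA; have := congr1 (mulmx (mxvec A)) (W1 g Gg Wg).
have AP : mxvec A *m sym_proj b = mxvec A.
  rewrite -scalemxAr mulmxDr mulmx1 -scalemxAr mul_vec_lin /= symA linearZ /=.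
  rewrite scalerA -signr_addb addbb scale1r -mulr2n -scaler_nat scalerA.
  by rewrite mulVf ?scale1r ?pnatr_eq0.
by rewrite mulmxA AP mul_vec_lin /= => /(can_inj mxvecK).
Qed.

(** The hypothesis reads [M^T A = A M^-1].  For [A = E_ij + e E_ji] with
    [e = 1] or [e = -1], comparing the entries in row [i] shows that [M^-1] is
    diagonal, by means of an index different from two given ones, and that its
    entry at [j] is the one of [M] at [i].  In dimension 2 all of SL_2 fixes the
    alternating forms. *)
Lemma fixes_forms_scalar (M : 'M[F]_d) (b : bool) : (2 < d)%N -> M \in unitmx ->
  (forall A : 'M[F]_d, A^T = (-1) ^+ b *: A -> M^T *m A *m M = A) ->
  exists2 c, c * c = 1 & M = c%:M.
Proof.
move=> d3 unitM fixM; pose H := invmx M; pose e : F := (-1) ^+ b.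
(* This is where dimension at least 3 enters. *)
have third (i j : 'I_d) : exists k, (k != i) && (k != j).
  apply/existsP; apply: contraT; rewrite negb_exists => /forallP none.
  have : (#|'I_d| <= #|[set i; j]|)%N.
    apply/subset_leq_card/subsetP => k _; have := none k.
    by rewrite negb_and !negbK !inE.
  by rewrite cards2 card_ord; case: (_ != _); lia.
pose A i j : 'M[F]_d := delta_mx i j + e *: delta_mx j i.
have MA i j : M^T *m A i j = A i j *m H.
  apply: (canRL (mulmxK unitM)); apply: fixM.
  rewrite /A linearD linearZ /= !trmx_delta scalerDr scalerA -signr_addb addbb.
  by rewrite scale1r addrC.
have lhsE i j p q : (M^T *m A i j) p q =
    M i p * (q == j)%:R + e * (M j p * (q == i)%:R).
  have deltaE k l : (M^T *m delta_mx k l) p q = M k p * (q == l)%:R.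
    by rewrite -[_ *m _]mulmx1 mulmx_delta_mulE !mxE eq_sym.
  by rewrite mulmxDr -scalemxAr mxE [X in _ + X]mxE !deltaE.
have rhsE i j p q : (A i j *m H) p q =
    (p == i)%:R * H j q + e * ((p == j)%:R * H i q).
  have deltaE k l : (delta_mx k l *m H) p q = (p == k)%:R * H l q.
    by rewrite -[delta_mx k l]mul1mx mulmx_delta_mulE !mxE.
  by rewrite mulmxDl -scalemxAl mxE [X in _ + X]mxE !deltaE.
have H0 j q : j != q -> H j q = 0.
  move=> jq; have [i /andP[ij iq]] := third j q.
  have := lhsE i j i q; rewrite MA rhsE eqxx (negPf ij) eq_sym (negPf jq) eq_sym.
  by rewrite (negPf iq) !(mul1r, mul0r, mulr0, addr0).
have diag i j : i != j -> M i i = H j j.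
  move=> ij; have := lhsE i j i j; rewrite MA rhsE !eqxx (negPf ij) eq_sym.
  by rewrite (negPf ij) !(mul1r, mul0r, mulr0, addr0, mulr1) => ->.
have i0 : 'I_d by exists 0%N; lia.
have Hc j : H j j = H i0 i0.
  by have [i /andP[ij ii0]] := third j i0; rewrite -(diag i j) // -(diag i i0).
have HE : H = (H i0 i0)%:M.
  apply/matrixP => p q; rewrite mxE; have [<-|/H0 -> //] := eqVneq p q.
  by rewrite Hc.
have c_gt0 : M i0 i0 = H i0 i0.
  by have [i /andP[ii0 _]] := third i0 i0; rewrite (diag i0 i) 1?eq_sym ?Hc.
have cM : H i0 i0 *: M = 1%:M by rewrite -mul_mx_scalar -HE mulmxV.
have cc : H i0 i0 * H i0 i0 = 1.
  by have /matrixP/(_ i0 i0) := cM; rewrite !mxE eqxx c_gt0.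
by exists (H i0 i0) => //; rewrite -[LHS]scale1r -cc -scalerA cM scalemx1.
Qed.

End Forms.

(** * Irreducible representations with scalar commutators *)

Section ScalarCommutators.

Variables (F : numClosedFieldType) (gT : finGroupType) (G : {group gT}).
Variables (d : nat) (rho : mx_representation F G d).
Hypothesis irr_rho : mx_irreducible rho.
Hypothesis comm_rho : {in G^`(1)%g, forall g, exists2 c, c * c = 1 & rho g = c%:M}.

Lemma comm_scalar g h : g \in G -> h \in G ->
  exists2 c, c * c = 1 & rho g *m rho h = c *: (rho h *m rho g).
Proof.
move=> Gg Gh; have G'gh : [~ g, h] \in G^`(1)%g by rewrite mem_commg.
have [c cc eq_c] := comm_rho G'gh; exists c => //.
have Ggh : [~ g, h] \in G by rewrite groupR.
have -> : rho g *m rho h = rho (h * g)%g *m rho [~ g, h].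
  have Ghg : (h * g)%g \in G by rewrite groupM.
  by rewrite -(repr_mxM rho Gg Gh) -(repr_mxM rho Ghg Ggh) commgC.
by rewrite eq_c mul_mx_scalar repr_mxM.
Qed.

(** Moving [h] past [g] twice multiplies by [c * c = 1]; conclude with Schur's
    lemma. *)
Lemma sqr_rcenter g : g \in G -> (g ^+ 2)%g \in rcenter rho.
Proof.
move=> Gg; rewrite inE groupX //=.
apply: mx_abs_irr_cent_scalar (splitG irr_rho) _ _.
apply/centgmxP => h Gh; have [c cc eq_c] := comm_scalar Gg Gh.
rewrite expgS expg1 repr_mxM // -mulmxA eq_c -scalemxAr mulmxA eq_c.
by rewrite -scalemxAl scalerA cc scale1r mulmxA.
Qed.

Lemma ch_rcenter g : g \in rcenter rho -> ch rho g^-1%g * ch rho g = d%:R ^+ 2.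
Proof.
case/setIdP=> Gg /is_scalar_mxP[c eq_c]; rewrite /ch repr_mxV // eq_c.
have c_neq0 : c != 0.
  have d_gt0 : (0 < d)%N by case/mx_irrP: irr_rho.
  apply: contraTneq d_gt0 => c0; rewrite -eqn0Ngt -(eqr_nat F) -(ch1 rho) /ch.
  by rewrite -(mulgV g) repr_mxM ?groupV // eq_c c0 raddf0 mul0mx mxtrace0.
rewrite invmx_scalar !mxtrace_scalar -[c^-1 *+ d]mulr_natr -[c *+ d]mulr_natr.
by rewrite mulrACA mulVf // mul1r expr2.
Qed.

(** Some [h] conjugates [rho g] to a multiple [c *: rho g] with [c != 1]. *)
Lemma ch_not_rcenter g : g \in G -> g \notin rcenter rho -> ch rho g = 0.
Proof.
move=> Gg; rewrite inE Gg /= => not_scalar.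
have [h Gh nc] : exists2 h, h \in G & rho g *m rho h != rho h *m rho g.
  apply/exists_inP; apply: contraR not_scalar.
  rewrite negb_exists_in => /forall_inP cent_g.
  apply: mx_abs_irr_cent_scalar (splitG irr_rho) _ _.
  by apply/centgmxP => h Gh; apply/eqP; rewrite -[_ == _]negbK cent_g.
have [c cc eq_c] := comm_scalar Gg Gh.
have c1 : c != 1 by apply: contraNneq nc => c1; rewrite eq_c c1 scale1r.
have tr_c : ch rho g = c * ch rho g.
  rewrite /ch -{1}[rho g](repr_mxK rho Gh) eq_c -scalemxAl linearZ /=.
  by rewrite mxtrace_mulC mulmxA -repr_mxM ?groupV // mulVg repr_mx1 mul1mx.
apply/eqP; move/eqP: tr_c; rewrite -subr_eq0 -{1}[ch rho g]mul1r -mulrBl.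
by rewrite mulf_eq0 subr_eq0 eq_sym (negPf c1).
Qed.

(** The norm of the character is 1; as the character vanishes off the centre
    and has absolute value [d] on it, the index of the centre is [d * d].  The
    quotient by the centre has exponent 2, so this index is a power of 2. *)
Lemma scalar_comm_degree : exists n, (d * d = 4 ^ n)%N.
Proof.
set Z := rcenter rho; have nZG : Z <| G := rcenter_normal rho.
have cardG : #|G|%:R = (#|Z| * (d * d))%:R :> F.
  have := dim_end_irr irr_rho => /(congr1 (fun n => n%:R : F)); rewrite dim_hom.
  move/(canRL (mulVKf (natG_neq0 F G))); rewrite mulr1 => <-.
  rewrite (big_setID Z) /= (setIidPr (normal_sub nZG)) /=.
  rewrite [X in _ + X]big1 ?addr0 => [|g /setDP[Gg nZg]]; last first.
    by rewrite (ch_not_rcenter Gg nZg) mulr0.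
  rewrite (eq_bigr _ ch_rcenter) sumr_const -[_ *+ #|_|]mulr_natl.
  by rewrite !natrM expr2.
have {cardG} : #|G / Z|%g = (d * d)%N.
  apply/eqP; rewrite card_quotient ?normal_norm //.
  rewrite -(eqn_pmul2l (cardG_gt0 (rcenter_group rho))) Lagrange ?normal_sub //.
  by rewrite -(eqr_nat F) cardG.
have : 2.-group (G / Z)%g.
  rewrite -pnat_exponent; apply: (@pnat_dvd _ 2) => //; apply/exponentP.
  move=> _ /morphimP[g Ng Gg ->]; rewrite -morphX //.
  by apply: coset_id; apply: sqr_rcenter.
rewrite /pgroup => pG card_q; move: pG; rewrite card_q pnatM => /andP[_].
by case/p_natP => n ->; exists n; rewrite -expnMn.
Qed.

End ScalarCommutators.

(** * McKay graphs that are forests *)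

Section McKayForest.

Variables (F : numClosedFieldType) (gT : finGroupType) (G : {group gT}).
Variables (d : nat) (rho : mx_representation F G d).
Hypothesis d_gt0 : (0 < d)%N.
Hypothesis forest : undirected_forest (McKay rho).

Local Notation a := (@adjacent (McKay rho)).
Local Notation chi i := (ch (irr_repr i)).
Local Notation v := (@irr_degree F gT G (Irr F G)).
Local Notation fus i j k := (multiplicity (prod_repr (irr_repr i) (irr_repr j)) k).
Local Notation one := (principal_comp (Irr F G)).
Implicit Types i j k x y z t : Irr F G.

Let asym := adjacent_sym forest.
Let airr := adjacent_irr forest.
Let acyc := adjacent_acyclic forest.

Lemma mult_rho x y : multiplicity (prod_repr (irr_repr x) rho) y = a x y.
Proof. exact: (edges_forest forest x y). Qed.

Lemma McKay_weight x : (d * v x = \sum_(y | a x y) v y)%N.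
Proof.
rewrite mulnC -(sum_mult_degree (prod_repr (irr_repr x) rho)) [RHS]big_mkcond.
by apply: eq_bigr => y _; rewrite mult_rho; case: (a x y); rewrite ?mul1n.
Qed.

Let v_gt0 x : (0 < v x)%N := irr_degree_gt0 x.

Lemma chi_one g : g \in G -> chi one g = 1.
Proof. by move=> Gg; rewrite /ch irr1_repr // mxtrace1 degree_irr1. Qed.

Lemma rho_neighbour k : multiplicity rho k = a one k.
Proof.
rewrite -mult_rho; apply: mult_ext => g Gg.
by rewrite ch_prod chi_one ?mul1r.
Qed.

(** Edges leaving the trivial representation count the constituents of [rho],
    edges arriving at it those of its dual; the graph is symmetric. *)
Lemma mult_dual_rho k : multiplicity (dual_repr rho) k = a one k.
Proof.
rewrite asym -mult_rho.
have := mult_adjoint (irr_repr k) rho (irr_repr one).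
rewrite sum_mult_irr; under [X in _ = X -> _]eq_bigr do rewrite mulnC.
rewrite sum_mult_irr => ->; apply: mult_ext => g Gg.
by rewrite ch_prod chi_one ?mulr1.
Qed.

Lemma rho_real : {in G, forall g, ch rho g^-1%g = ch rho g}.
Proof.
move=> g Gg; rewrite -ch_dual; apply: ch_ext Gg => k.
by rewrite mult_dual_rho rho_neighbour.
Qed.

Lemma fus_pos_le i j k : (0 < fus i j k)%N -> (v k <= v i * v j)%N.
Proof.
move=> pos; rewrite -(sum_mult_degree (prod_repr (irr_repr i) (irr_repr j))).
by rewrite (bigD1 k) //=; apply: leq_trans (leq_addr _ _); rewrite leq_pmull.
Qed.

(** Otherwise [x], [z], [y], [t] form a cycle of length 4. *)
Lemma common_neighbour x y z t : x != y -> a x z -> a z y -> a x t -> a t y -> z = t.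
Proof.
move=> nxy xz zy xt ty; apply/eqP; apply: contraT => nzt.
have := nbwalk_uniq airr acyc (x := z) (y := x) (p := [:: t; y; z]).
rewrite /= asym xz xt ty (asym y) zy [t == z]eq_sym nzt [y == x]eq_sym nxy.
by rewrite !inE eqxx !orbT => /(_ isT isT).
Qed.

Section TwoConstituents.

Variables t1 t2 : Irr F G.
Hypotheses (nt : t1 != t2) (at1 : a one t1) (at2 : a one t2).

(** The constituents of [t1 t2] are adjacent to both [t1] and [t2]: only the
    trivial representation is. *)
Lemma two_constituents_linear : v t1 = 1%N /\ v t2 = 1%N.
Proof.
have adj i j s : a one j -> (0 < fus i j s)%N -> a i s.
  move=> aj pos; suff : (0 < a i s)%N by rewrite lt0b.
  rewrite -mult_rho mult_prodr (bigD1 j) //=.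
  by rewrite rho_neighbour aj mul1n addn_gt0 pos.
have only_one s : (0 < fus t1 t2 s)%N -> s = one.
  move=> pos; have t1s := adj _ _ _ at2 pos.
  have t2s : a t2 s by apply: (adj t2 t1) => //; rewrite mult_prodC.
  by apply: (common_neighbour nt); rewrite // asym.
have le1 : (fus t1 t2 one <= 1)%N.
  have t1one : a t1 one by rewrite asym.
  have : (fus t1 t2 one <= a t1 one)%N; last by rewrite t1one.
  rewrite -mult_rho [X in (_ <= X)%N]mult_prodr (bigD1 t2) //= rho_neighbour at2 mul1n.
  exact: leq_addr.
have := sum_mult_degree (prod_repr (irr_repr t1) (irr_repr t2)).
rewrite (bigD1 one) //= degree_irr1 muln1 big1 ?addn0 => [|s ns]; last first.
  have [->|/only_one s1] := posnP (fus t1 t2 s); first by rewrite mul0n.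
  by rewrite s1 eqxx in ns.
move=> prod_v; have : (v t1 * v t2 == 1)%N.
  by rewrite eqn_leq -{1}prod_v le1 muln_gt0 !v_gt0.
by rewrite muln_eq1 => /andP[/eqP -> /eqP ->].
Qed.

End TwoConstituents.

(** With two constituents all constituents of [rho] would be linear, so that
    neighbours have equal dimensions; at a leaf the equation for the weights
    gives [d = 1], which leaves room for one constituent only. *)
Lemma rho_irr : exists r, forall k, multiplicity rho k = (r == k).
Proof.
have [r ar] : exists r, a one r.
  exact: (@weight_neighbour_exists (McKay rho) d v d_gt0 v_gt0 McKay_weight one).
exists r => k; rewrite rho_neighbour.
have [<-|nrk] := eqVneq r k; first by rewrite ar.
apply/eqP; rewrite eqb0; apply/negP => ak.
have lin t : a one t -> v t = 1%N.
  have [<- _|nrt at_] := eqVneq r t; first by case: (two_constituents_linear nrk ar ak).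
  by case: (two_constituents_linear nrt ar at_).
have le_v x y : a x y -> (v y <= v x)%N.
  move=> xy; have : (0 < multiplicity (prod_repr (irr_repr x) rho) y)%N.
    by rewrite mult_rho xy.
  rewrite mult_prodr lt0n sum_nat_eq0 => /forall_inPn[i _].
  rewrite muln_eq0 negb_or rho_neighbour eqb0 negbK -lt0n => /andP[ai].
  by move/fus_pos_le; rewrite (lin i ai) muln1.
have eq_v x y : a x y -> v x = v y.
  by move=> xy; apply/eqP; rewrite eqn_leq !le_v // asym.
have [y [z [_ yz leaf]]] := leaf_exists asym airr acyc ar.
have d1 : d = 1%N.
  apply/eqP; rewrite -(eqn_pmul2r (v_gt0 y)) McKay_weight mul1n.
  rewrite (bigD1 z) //= big1 ?addn0 -?(eq_v y z) // => w /andP[/leaf ->].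
  by rewrite eqxx.
have := sum_mult_degree rho; rewrite (bigD1 r) //= (bigD1 k) 1?eq_sym //=.
rewrite !rho_neighbour ar ak (lin r ar) (lin k ak) => sum_d.
by have := leq_addr (\sum_(i | (i != r) && (i != k)) multiplicity rho i * v i) 2; lia.
Qed.

Section Constituent.

Variable r : Irr F G.
Hypothesis rho_r : forall k, multiplicity rho k = (r == k).

Let ch_rho : {in G, ch rho =1 chi r} := ch_irr rho_r.

Lemma degree_r : d = v r.
Proof.
rewrite -[LHS](sum_mult_degree rho) (bigD1 r) //= rho_r eqxx mul1n big1 ?addn0 // => i.
by rewrite eq_sym rho_r => /negPf ->.
Qed.

Lemma rho_rsim : mx_rsim rho (irr_repr r).
Proof. by apply: mult_rsim degree_r; rewrite rho_r eqxx. Qed.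

Lemma rho_irreducible : mx_irreducible rho.
Proof. exact: mx_rsim_irr (mx_rsim_sym rho_rsim) (irr_irr r). Qed.

Lemma rho_self_dual : mx_rsim rho (dual_repr rho).
Proof.
apply: mx_rsim_trans rho_rsim (mx_rsim_sym _); apply: mult_rsim degree_r.
by rewrite mult_dual_rho -rho_neighbour rho_r eqxx.
Qed.

Lemma mult_square k : multiplicity (prod_repr rho rho) k = a r k.
Proof.
rewrite -mult_rho; apply: mult_ext => g Gg.
by rewrite !ch_prod ch_rho.
Qed.

(** Both sides compute the multiplicity of [t] in [x (x) rho (x) rho]. *)
Lemma walk2 x t : (\sum_y a x y * a y t = \sum_k a r k * fus x k t)%N.
Proof.
have := mult_prodA (irr_repr x) rho rho t.
rewrite mult_prodl mult_prodr; under eq_bigr do rewrite !mult_rho.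
by under [X in _ = X -> _]eq_bigr do rewrite mult_square.
Qed.

Lemma two_step x k t : a r k -> (0 < fus x k t)%N -> exists2 y, a x y & a y t.
Proof.
move=> ark pos; have : (0 < \sum_y a x y * a y t)%N.
  by rewrite walk2 (bigD1 k) //= ark mul1n addn_gt0 pos.
rewrite lt0n sum_nat_eq0 => /forall_inPn[y _].
by rewrite muln_eq0 !eqb0 negb_or !negbK => /andP[xy yt]; exists y.
Qed.

(** A constituent of [i (x) j] is a constituent of both [i (x) rho (x) rho] and
    [j (x) rho (x) rho].  If its walks to [i] and to [j] avoided [r], they would
    close up, through [r], to a cycle of length 4 or 6. *)
Lemma fus_neighbour i j t :
  a r i -> a r j -> i != j -> (0 < fus i j t)%N -> a r t.
Proof.
move=> ri rj nij pos.
have [y iy yt] := two_step rj pos.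
have [z jz zt] : exists2 z, a j z & a z t.
  by apply: (two_step ri); rewrite mult_prodC.
have [<- //|nit] := eqVneq i t; have [<- //|njt] := eqVneq j t.
have [->|nry] := eqVneq r y; first exact: yt.
have [->|nrz] := eqVneq r z; first exact: zt.
have [yz|nyz] := eqVneq y z.
  have ry : r = y.
    by apply: (common_neighbour nij); rewrite // asym // yz.
  by rewrite -ry eqxx in nry.
have := nbwalk_uniq airr acyc (x := r) (y := i) (p := [:: y; t; z; j; r]).
rewrite /= ri iy yt (asym t) zt (asym z) jz (asym j) rj.
rewrite [y == r]eq_sym nry [t == i]eq_sym nit [z == y]eq_sym nyz njt nrz.
by rewrite !inE eqxx !orbT => /(_ isT isT).
Qed.

Lemma fus_dual i j j' k : {in G, chi j' =1 fun g => chi j g^-1%g} ->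
  fus i j' k = fus j k i.
Proof.
move=> dual_j; have := mult_adjoint (irr_repr i) (irr_repr j') (irr_repr k).
rewrite sum_mult_irr; under [X in _ = X -> _]eq_bigr do rewrite mulnC.
rewrite sum_mult_irr => ->; apply: mult_ext => g Gg.
by rewrite !ch_prod ch_dual dual_j ?groupV // invgK.
Qed.

Lemma mult_dual_index n (V : mx_representation F G n) j j' :
  {in G, chi j' =1 fun g => chi j g^-1%g} ->
  {in G, forall g, ch V g^-1%g = ch V g} ->
  multiplicity V j' = multiplicity V j.
Proof.
move=> dual_j real_V; apply/eqP; rewrite -(eqr_nat F) !multE /cdot; apply/eqP.
congr (_ * _); rewrite (reindex_inj invg_inj) /=.
apply: eq_big => g; rewrite ?groupV // => Gg.
by rewrite invgK dual_j ?groupV // invgK real_V.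
Qed.

(** Let [i (x) j'] be decomposed, with [j'] the dual of [j].  The only walk of
    length 2 from [j] to [i] passes through [r], so exactly one neighbour of [r]
    occurs, with multiplicity 1; and nothing else occurs, by [fus_neighbour].
    Hence [v i * v j] is the dimension of a neighbour of [r], at most [v i]. *)
Lemma neighbour_degree i j j' :
  {in G, chi j' =1 fun g => chi j g^-1%g} ->
  a r i -> (forall k, a r k -> (v k <= v i)%N) ->
  a r j -> i != j -> i != j' -> v j = 1%N.
Proof.
move=> dual_j ri max_i rj nij nij'.
have v_j' : v j' = v j.
  apply/eqP; rewrite -(eqr_nat F) -!(ch1 (irr_repr _)) dual_j //.
  by rewrite invg1 !ch1.
have rj' : a r j'.
  suff : (0 < a r j')%N by rewrite lt0b.
  rewrite -mult_square (mult_dual_index dual_j) ?mult_square ?rj // => g Gg.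
  by rewrite !ch_prod !rho_real.
have walks : (\sum_k a r k * fus i j' k = 1)%N.
  under eq_bigr do rewrite (fus_dual _ _ dual_j).
  rewrite -walk2 (bigD1 r) //= (asym j) rj ri big1 // => y nyr.
  apply/eqP; rewrite muln_eq0 !eqb0 -negb_and; apply: contra nyr => /andP[jy yi].
  by apply/eqP; apply: (common_neighbour (x := j) (y := i)); rewrite // 1?eq_sym 1?asym.
have : (v i * v j' <= v i)%N.
  rewrite -(sum_mult_degree (prod_repr (irr_repr i) (irr_repr j'))).
  rewrite -[X in (_ <= X)%N]mul1n -walks big_distrl /=; apply: leq_sum => k _.
  have [->|pos] := posnP (fus i j' k); first by rewrite mul0n.
  have rk := fus_neighbour ri rj' nij' pos.
  by rewrite rk mul1n leq_mul2l max_i // orbT.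
rewrite v_j' -[X in (_ <= X)%N]muln1 leq_pmul2l // => le1.
by apply/eqP; rewrite eqn_leq le1 v_gt0.
Qed.

Lemma one_neighbour : a r one.
Proof.
suff : (0 < a one r)%N by rewrite lt0b asym.
by rewrite -rho_neighbour rho_r eqxx.
Qed.

(** Choose a neighbour [i] of [r] of maximal dimension.  By [neighbour_degree]
    only [i] and its dual can be nonlinear; they occur in the same one of the
    symmetric and the alternating square, because both have real characters, so
    the other one serves as [W]. *)
Lemma linear_part : (2 < d)%N -> exists (b : bool) n (W : mx_representation F G n),
  {in G, forall g, W g = 1%:M -> forall A : 'M[F]_d,
     A^T = (-1) ^+ b *: A -> (rho g)^T *m A *m rho g = A} /\
  forall k, (0 < multiplicity W k)%N -> v k = 1%N.
Proof.
move=> d3; have [n0 [W0 [chW0 fix0]]] := sym_repr rho false.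
have [n1 [W1 [chW1 fix1]]] := sym_repr rho true.
have sum_W k : (multiplicity W0 k + multiplicity W1 k)%N = a r k.
  rewrite -mult_square; apply/esym.
  pose n (b : bool) := if b then n1 else n0.
  pose W (b : bool) : mx_representation F G (n b) :=
    if b return mx_representation F G (n b) then W1 else W0.
  rewrite (@mult_comb _ _ _ bool _ _ n W (fun=> 1%N)) => [|g Gg].
    by rewrite big_bool /= !mul1n addnC.
  rewrite big_bool /= !mul1r chW0 // chW1 // -mulrDr addrACA -mulrDl !ch_prod.
  rewrite expr0 expr1 -mulrDl addNr mul0r addr0 -mulr2n.
  by rewrite mulrnAl -[X in _ = _ * X]mulr_natl mulKf // pnatr_eq0.
have real_W n (W : mx_representation F G n) (b : bool) :
    {in G, forall g, ch W g =
      2%:R^-1 * (ch rho g ^+ 2 + (-1) ^+ b * \tr (rho g *m rho g))} ->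
    {in G, forall g, ch W g^-1%g = ch W g}.
  move=> chW g Gg; rewrite !chW ?groupV // rho_real // -!repr_mxM ?groupV //.
  by rewrite -invMg -[\tr (rho _^-1%g)]/(ch rho _) rho_real ?groupM.
pose i := [arg max_(i > one | a r i) v i].
have [ri max_i] : a r i /\ forall k, a r k -> (v k <= v i)%N.
  by rewrite /i; case: arg_maxnP => //; apply: one_neighbour.
have [i' dual_i] := dual_irr i.
have lin_W n (W : mx_representation F G n) : multiplicity W i = 0%N ->
    {in G, forall g, ch W g^-1%g = ch W g} ->
    (forall k, multiplicity W k <= a r k)%N ->
    forall k, (0 < multiplicity W k)%N -> v k = 1%N.
  move=> Wi real_V le_W k Wk; have rk : a r k.
    by have := leq_trans Wk (le_W k); rewrite lt0b.
  have [k' dual_k] := dual_irr k.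
  apply: (neighbour_degree dual_k ri max_i rk).
    by apply: contraTneq Wk => <-; rewrite Wi.
  apply: contraTneq Wk => ik'; rewrite -(mult_dual_index dual_k real_V).
  by rewrite -ik' Wi.
have [Wi|Wi] := posnP (multiplicity W0 i).
  exists false, n0, W0; split=> //; apply: lin_W => //; first exact: real_W chW0.
  by move=> k; rewrite -sum_W leq_addr.
exists true, n1, W1; split=> //; apply: lin_W; last 2 first.
- exact: real_W chW1.
- by move=> k; rewrite -sum_W leq_addl.
by have := sum_W i; rewrite ri; lia.
Qed.

Lemma der1_scalar : d != 2%N ->
  {in G^`(1)%g, forall g, exists2 c, c * c = 1 & rho g = c%:M}.
Proof.
move=> d2 g G'g; have Gg : g \in G by apply: subsetP (der_sub 1 G) g G'g.
have [d3|d_le2] := ltnP 2 d.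
  have [b [n [W [fixW linW]]]] := linear_part d3.
  apply: (fixes_forms_scalar (b := b) d3 (repr_mx_unit rho Gg)).
  by apply: fixW => //; apply: trivial_on_der1.
have d1 : d = 1%N by lia.
by have /subsetP/(_ g G'g)/rkerP[_ ->] := rker_linear rho d1; exists 1; rewrite ?mulr1.
Qed.

Lemma linear_neighbour k : d != 2%N -> a r k -> v k = 1%N.
Proof.
move=> d2 rk; apply: (@linear_constituent _ _ _ _ (form_repr rho)) => [g G'g|].
  apply/row_matrixP => i; rewrite !rowE mul_rV_lin /=.
  have [c cc ->] := der1_scalar d2 G'g.
  rewrite tr_scalar_mx mul_scalar_mx mul_mx_scalar scalerA cc scale1r vec_mxK.
  by rewrite mulmx1.
rewrite -(mult_ext (V := prod_repr rho rho)) ?mult_square ?rk // => g _.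
by rewrite ch_prod ch_form.
Qed.

(** Each of [x] and [y] occurs in the product of the other one with a linear
    constituent of [rho (x) rho], so neither has the larger dimension. *)
Lemma distance2_degree z x y : d != 2%N -> a z x -> a z y -> v x = v y.
Proof.
move=> d2; suff le z' x' y' : a z' x' -> a z' y' -> (v y' <= v x')%N.
  by move=> zx zy; apply/eqP; rewrite eqn_leq !(le z).
rewrite (asym z') => xz zy.
have : (0 < \sum_t a x' t * a t y')%N by rewrite (bigD1 z') //= xz zy.
rewrite walk2 lt0n sum_nat_eq0 => /forall_inPn[k _].
rewrite muln_eq0 negb_or eqb0 negbK -lt0n => /andP[rk].
by move/fus_pos_le; rewrite (linear_neighbour d2 rk) muln1.
Qed.

End Constituent.

Lemma McKay_irreducible : mx_irreducible rho /\ mx_rsim rho (dual_repr rho).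
Proof.
have [r rho_r] := rho_irr.
by split; [apply: rho_irreducible rho_r | apply: rho_self_dual rho_r].
Qed.

Lemma McKay_hedgehog x : d != 2%N ->
  graph_iso (component (x : McKay rho)) (hedgehog (d * d)).
Proof.
move=> d2; have [r rho_r] := rho_irr.
apply: (equal_weights_hedgehog forest d_gt0 v_gt0 McKay_weight) => z y y'.
exact: (distance2_degree rho_r d2).
Qed.

Lemma McKay_degree : d != 2%N -> exists n, (d * d = 4 ^ n)%N.
Proof.
move=> d2; have [r rho_r] := rho_irr.
exact: scalar_comm_degree (rho_irreducible rho_r) (der1_scalar rho_r d2).
Qed.

End McKayForest.

Theorem theorem1 (R : realType) (gT : finGroupType) (G : {group gT})
    (d : nat) (rho : mx_representation (complexes R) G d) :
  (0 < d)%N ->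
  undirected_forest (McKay rho) ->
  [/\ (* (1) *)
      mx_irreducible rho /\ mx_rsim rho (dual_repr rho),
      (* (2) *)
      forall x : McKay rho,
        [\/ exists2 n : nat, (4 <= n)%N
              & graph_iso (component x) (affineD n),
            exists2 n : nat, n \in [:: 6; 7; 8]%N
              & graph_iso (component x) (affineE n)
          | exists n : nat, graph_iso (component x) (hedgehog (4 ^ n)%N)]
    & forall (x : McKay rho) (n : nat), n <> 1%N ->
        graph_iso (component x) (hedgehog (4 ^ n)%N) ->
        forall y : McKay rho, graph_iso (component x) (component y)].
Proof.
move=> d_gt0 forest.
pose v : McKay rho -> nat := @irr_degree _ gT G (Irr (complexes R) G).
have v_gt0 x : (0 < v x)%N := irr_degree_gt0 x.
have v_d : forall x : McKay rho, (d * v x = \sum_(y | adjacent x y) v y)%N.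
  exact: McKay_weight forest.
split; first exact: McKay_irreducible d_gt0 forest.
  move=> x; have [d2|d2] := eqVneq d 2%N.
    have v_2 y : (2 * v y = \sum_(z | adjacent y z) v z)%N by rewrite -d2.
    have [] := affine_component forest v_gt0 v_2 x.
    - by constructor 1.
    - by constructor 2.
    by constructor 3; exists 1%N.
  constructor 3; have [n eq_n] := McKay_degree d_gt0 forest d2.
  by exists n; rewrite -eq_n; apply: McKay_hedgehog.
move=> x n n1 iso_x y.
have eq_d := hedgehog_weight forest v_gt0 v_d iso_x.
have d2 : d != 2%N.
  apply: contra_notN n1 => /eqP d2; move: eq_d; rewrite d2.
  by move/eqP; rewrite -[(2 * 2)%N]/(4 ^ 1)%N eqn_exp2l // => /eqP.
rewrite {}eq_d in iso_x; apply: graph_iso_trans iso_x (graph_iso_sym _).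
exact: McKay_hedgehog.
Qed.
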